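(* There exists a bounded simply-connected pointed domain $(W,w)$ in $\mathbb{C}$ such that $\partial W$ is locally connected, $\overline W$ is computable, and there exists a computable Carathéodory modulus $\eta(r)$ of $(W,w)$ with $\eta(r)\searrow0$ as $r\searrow0$; however, no computable modulus of local connectivity exists for $\partial W$.
   Context: A pointed domain $(W,w)$ is a simply-connected domain $W\subset\mathbb{C}$ with a point $w\in W$. A crosscut $\gamma\subset W$ is a homeomorphic image of $(0,1)$ whose closure is homeomorphic to $[0,1]$ with the two endpoints in $\partial W$. If $w\notin\gamma$, the crosscut neighborhood $N_\gamma$ is the component of $W\setminus\gamma$ not containing $w$. A strictly increasing function $\eta:(0,a)\to\mathbb{R}$ is called a Carathéodory modulus of $(W,w)$ if for every crosscut $\gamma$ with $\operatorname{diam}(\gamma)<r<a$ we have $\operatorname{diam}N_\gamma<\eta(r)$. For a connected set $X\subset\mathbb{R}^2$, a strictly increasing function $m:(0,a)\to\mathbb{R}$ is a modulus of local connectivity of $X$ if (i) for all $x,y\in X$ with $\operatorname{dist}(x,y)<r<a$ there is a connected subset $L\subset X$ containing both $x$ and $y$ with $\operatorname{diam}(L)<m(r)$; and (ii) $m(r)\searrow0$ as $r\searrow0$. A compact set $K\subset\mathbb{C}$ is computable if there is an algorithm which on input $n\in\mathbb{N}$ outputs a finite collection of closed balls with rational centers and radii whose union is at Hausdorff distance less than $2^{-n}$ from $K$. A function $F:(0,a)\to\mathbb{R}$ is computable if there is an algorithm which, given $n\in\mathbb{N}$ and an oracle for $x\in(0,a)$ (a function whose value at $m\in\mathbb{N}$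 is a rational within $2^{-m}$ of $x$), outputs a rational within $2^{-n}$ of $F(x)$. *)

(* Defs.v *)
From HB Require Import structures.
From mathcomp Require Import all_boot all_order all_algebra.
From mathcomp Require Import all_classical all_reals all_analysis.

Set Implicit Arguments.
Unset Strict Implicit.
Unset Printing Implicit Defensive.

Import Order.TTheory GRing.Theory Num.Theory.
Import numFieldNormedType.Exports.

Local Open Scope classical_set_scope.
Local Open Scope ring_scope.

(* Model of computation: Kleene's partial recursive functions relative to an
   oracle [phi : nat -> nat], in the unary presentation in which several
   arguments are packed into one by Cantor's pairing bijection. *)

Definition cpair (a b : nat) : nat := ('C((a + b).+1, 2) + b)%N.

Fixpoint unpair (n : nat) : nat * nat :=
  if n is n'.+1 then
    let: (a, b) := unpair n' in if a is a'.+1 then (a', b.+1) else (b.+1, 0%N)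
  else (0%N, 0%N).

Lemma cpairS a b : cpair a b.+1 = (cpair a.+1 b).+1.
Proof. by rewrite /cpair addnS addSn addnS. Qed.

Lemma cpairS0 a : cpair a.+1 0 = (cpair 0 a).+1.
Proof. by rewrite /cpair !addn0 add0n binS bin1 addnS. Qed.

Lemma cpairK a b : unpair (cpair a b) = (a, b).
Proof.
have [s] := ubnP (a + b)%N; elim: s a b => // s IHs a b.
elim: b a => [[|a]|b IHb a] lt_s.
- by [].
- by rewrite cpairS0 /= IHs // add0n; move: lt_s; rewrite addn0 ltnS.
- by rewrite cpairS /= IHb // addSn -addnS.
Qed.

Lemma unpairK n : cpair (unpair n).1 (unpair n).2 = n.
Proof.
elim: n => //= n; case: (unpair n) => [[|a] b] /= IHn.
  by rewrite cpairS0 IHn.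
by rewrite cpairS IHn.
Qed.

Inductive code : Type :=
| Zero | Succ | Fst | Snd | Oracle
| Pair of code & code
| Comp of code & code
| Prec of code & code
| Mu of code.

Inductive eval (phi : nat -> nat) : code -> nat -> nat -> Prop :=
| eval_Zero n : eval phi Zero n 0%N
| eval_Succ n : eval phi Succ n n.+1
| eval_Fst n : eval phi Fst n (unpair n).1
| eval_Snd n : eval phi Snd n (unpair n).2
| eval_Oracle n : eval phi Oracle n (phi n)
| eval_Pair f g n a b :
    eval phi f n a -> eval phi g n b -> eval phi (Pair f g) n (cpair a b)
| eval_Comp f g n a b :
    eval phi g n a -> eval phi f a b -> eval phi (Comp f g) n b
| eval_Prec0 f g n a :
    eval phi f n a -> eval phi (Prec f g) (cpair n 0) a
| eval_PrecS f g n k a b :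
    eval phi (Prec f g) (cpair n k) a ->
    eval phi g (cpair n (cpair k a)) b ->
    eval phi (Prec f g) (cpair n k.+1) b
| eval_Mu f n k (h : nat -> nat) :
    (forall i, (i < k)%N -> eval phi f (cpair n i) (h i).+1) ->
    eval phi f (cpair n k) 0%N ->
    eval phi (Mu f) n k.

Lemma eval_functional phi c n u v : eval phi c n u -> eval phi c n v -> u = v.
Proof.
have cpairI a b a' b' : cpair a b = cpair a' b' -> a = a' /\ b = b'.
  by move=> /(congr1 unpair); rewrite !cpairK => -[-> ->].
move=> ev; elim: ev v => {c n u} [n|n|n|n|n|f g n a b _ IHa _ IHb
  |f g n a b _ IHa _ IHb|f g n a _ IHa|f g n k a b _ IHa _ IHb
  |f n k h _ IHh _ IHk] v ev; inversion ev; subst => //;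
  try match goal with
  | E : cpair _ _ = cpair _ _ |- _ => case: (cpairI _ _ _ _ E) => // ? [?]
  end; subst => //.
- by rewrite (IHa _ H1) (IHb _ H4).
- by apply: IHb; rewrite (IHa _ H1).
- by apply: IHa; have [<- _] := cpairI _ _ _ _ H2.
- by apply: IHb; rewrite (IHa _ H2).
- case: (ltngtP k v) => // lt; first by have := IHk _ (H0 _ lt).
  by have := IHh _ lt _ H1.
Qed.

(* Numerical representations of the outputs. [CodeSeq.decode] is the standard
   effective bijection from [nat] onto [seq nat]. *)

Definition rat_of_code (n : nat) : rat :=
  let: (c, q) := unpair n in let: (p, p') := unpair c in
  (p%:Q - p'%:Q) / q.+1%:Q.

Definition posrat_of_code (n : nat) : rat :=
  let: (p, q) := unpair n in p.+1%:Q / q.+1%:Q.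

Section Plane.
Variable R : realType.

(* C is identified with R * R. The library's norm on R * R is the sup norm: it
   gives the Euclidean topology and the same bounded sets, but distances and
   diameters have to be taken with respect to [dist]. *)
Notation C := (R * R)%type.

Definition dist (x y : C) : R :=
  Num.sqrt ((x.1 - y.1) ^+ 2 + (x.2 - y.2) ^+ 2).

Definition diam (A : set C) : \bar R :=
  ereal_sup [set (dist p.1 p.2)%:E | p in A `*` A].

Definition dist_to (A : set C) (x : C) : \bar R :=
  ereal_inf [set (dist x y)%:E | y in A].

Definition hausdorff_dist (A B : set C) : \bar R :=
  Order.max (ereal_sup [set dist_to B x | x in A])
            (ereal_sup [set dist_to A y | y in B]).

Definition boundary (A : set C) : set C := closure A `\` interior A.

Definition locally_connected (X : set C) : Prop :=
  forall (x : C) (U : set C), X x -> open U -> U x ->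
  exists V : set C, [/\ open V, V x, X `&` V `<=` U & connected (X `&` V)].

Definition homeo_on (T U : topologicalType) (A : set T) (B : set U)
    (f : T -> U) : Prop :=
  [/\ {within A, continuous f}, set_bij A B f &
      exists2 g : U -> T,
        {within B, continuous g} & forall x, A x -> g (f x) = x].

Definition null_homotopic_in (W : set C) (f : R -> C) : Prop :=
  exists H : R * R -> C,
  [/\ {within `[0, 1] `*` `[0, 1], continuous H},
      H @` (`[0, 1] `*` `[0, 1]) `<=` W,
      (forall t, 0 <= t <= 1 -> H (0, t) = f t /\ H (1, t) = f 0) &
      (forall s, 0 <= s <= 1 -> H (s, 0) = f 0 /\ H (s, 1) = f 0)].

Definition simply_connected (W : set C) : Prop :=
  connected W /\
  forall f : R -> C, {within `[0, 1], continuous f} ->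
    f @` `[0, 1] `<=` W -> f 0 = f 1 -> null_homotopic_in W f.

Definition pointed_domain (W : set C) (w : C) : Prop :=
  [/\ open W, simply_connected W & W w].

Definition crosscut (W gamma : set C) : Prop :=
  [/\ gamma `<=` W,
      (exists f : R -> C, homeo_on (`]0, 1[ : set R) gamma f) &
      (exists f : R -> C, [/\ homeo_on (`[0, 1] : set R) (closure gamma) f,
                              boundary W (f 0) & boundary W (f 1)])].

(* Stated as a relation: that exactly one such N exists is a theorem of plane
   topology. *)
Definition crosscut_nbhd (W : set C) (w : C) (gamma N : set C) : Prop :=
  (exists2 x, (W `\` gamma) x & N = connected_component (W `\` gamma) x)
  /\ ~ N w.

(* A function (0,a) -> R is represented by a total function; its values outside
   (0,a) are never used. *)
Definition strictly_increasing (a : R) (F : R -> R) : Prop :=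
  forall r s : R, 0 < r -> r < s -> s < a -> F r < F s.

Definition caratheodory_modulus (W : set C) (w : C) (a : R) (eta : R -> R) :
    Prop :=
  strictly_increasing a eta /\
  forall gamma N : set C,
    crosscut W gamma -> ~ gamma w -> crosscut_nbhd W w gamma N ->
    forall r : R, (diam gamma < r%:E)%E -> r < a -> (diam N < (eta r)%:E)%E.

Definition local_connectivity_modulus (X : set C) (a : R) (m : R -> R) :
    Prop :=
  [/\ strictly_increasing a m,
      (forall (x y : C) (r : R), X x -> X y -> dist x y < r -> r < a ->
         exists L : set C, [/\ L `<=` X, connected L, L x, L y &
                               (diam L < (m r)%:E)%E]) &
      m r @[r --> 0^'+] --> (0 : R)].

Definition closed_disk (c : C) (r : R) : set C := [set z | dist c z <= r].

Definition disk_of_code (n : nat) : set C :=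
  let: (c, r) := unpair n in let: (x, y) := unpair c in
  closed_disk (ratr (rat_of_code x), ratr (rat_of_code y))
              (ratr (posrat_of_code r)).

Definition disks_of_code (n : nat) : set C :=
  \bigcup_(d in [set` CodeSeq.decode n]) disk_of_code d.

(* The constantly zero oracle stands for "no oracle". *)
Definition computable_compact (K : set C) : Prop :=
  compact K /\
  exists c : code, forall n : nat, exists2 v : nat,
    eval (fun=> 0%N) c n v &
    (hausdorff_dist (disks_of_code v) K < (2 ^- n)%:E)%E.

Definition oracle_for (x : R) (phi : nat -> nat) : Prop :=
  forall m : nat, `|ratr (rat_of_code (phi m)) - x| < 2 ^- m.

Definition computable_on (a : R) (F : R -> R) : Prop :=
  exists c : code, forall (x : R) (phi : nat -> nat),
    0 < x -> x < a -> oracle_for x phi ->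
    forall n : nat, exists2 v : nat,
      eval phi c n v & `|ratr (rat_of_code v) - F x| < 2 ^- n.

End Plane.

(* Main.v *)
Require Import Defs.
From mathcomp Require Import all_boot all_order all_algebra.
From mathcomp Require Import all_classical all_reals all_analysis.
From mathcomp Require Import ring lra.
Require Import Defs.
Set Implicit Arguments.
Unset Strict Implicit.
Unset Printing Implicit Defensive.
Import Order.TTheory GRing.Theory Num.Theory.
Import numFieldNormedType.Exports.
Local Open Scope classical_set_scope.
Local Open Scope ring_scope.

(* Proof idea. The domain is the unit square with triangular fjords cut into its
   upper side. The n-th fjord is present exactly when n belongs to a semidecidable
   undecidable set; it has depth 2^-(n+3), which does not depend on the stage t
   at which n is enumerated, but half-width only 2^-(n+t+4).

   The closure is computable because a fjord that has not been found yet is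
   narrow. Between the fjords the domain is as wide as the neighbouring fjords
   are deep. So if a crosscut of diameter < r lies in a box of size r around its
   endpoint p, every point outside a box of size 4r can be joined to w by a
   polygonal path avoiding the crosscut: 32r is a Caratheodory modulus, and no
   separation theorem for plane curves is needed.

   Two points of the boundary on either side of the mouth of the n-th fjord are
   2^-(n+t+3) apart, but a connected part of the boundary joining them passes
   through the abscissa of the tip. A modulus m of local connectivity is thus
   larger than 2^-(n+3) at every r > 2^-(n+t+3), and a computable m would yield
   a computable bound on the stage t, hence decide the undecidable set. *)

(** * Recursive functions and decidable sets *)

Definition recursive (f : nat -> nat) : Prop :=
  exists c, forall phi n, eval phi c n (f n).

Lemma recursive_ext f g : f =1 g -> recursive f -> recursive g.
Proof. by move=> fg [c cP]; exists c => phi n; rewrite -fg. Qed.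

Lemma recursive_id : recursive id.
Proof.
exists (Pair Fst Snd) => phi n; rewrite -[n in X in eval _ _ _ X]unpairK.
by apply: eval_Pair; constructor.
Qed.

Lemma recursive_comp f g :
  recursive f -> recursive g -> recursive (fun n => f (g n)).
Proof.
move=> [cf cfP] [cg cgP]; exists (Comp cf cg) => phi n.
exact: eval_Comp (cgP _ _) (cfP _ _).
Qed.

Lemma recursive_S f : recursive f -> recursive (fun n => (f n).+1).
Proof. by apply: (recursive_comp (f := S)); exists Succ; constructor. Qed.

Lemma recursive_const k : recursive (fun=> k).
Proof. by elim: k => [|k /recursive_S//]; exists Zero; constructor. Qed.

Lemma recursive_fst f : recursive f -> recursive (fun n => (unpair (f n)).1).
Proof.
by apply: (recursive_comp (f := fun n => (unpair n).1)); exists Fst; constructor.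
Qed.

Lemma recursive_snd f : recursive f -> recursive (fun n => (unpair (f n)).2).
Proof.
by apply: (recursive_comp (f := fun n => (unpair n).2)); exists Snd; constructor.
Qed.

Lemma recursive_cpair f g :
  recursive f -> recursive g -> recursive (fun n => cpair (f n) (g n)).
Proof.
move=> [cf cfP] [cg cgP]; exists (Pair cf cg) => phi n.
exact: eval_Pair.
Qed.

(** The step may depend on the parameter [n] because [eval_PrecS] hands it the whole packed triple
    of parameter, counter and accumulated value. *)
Lemma recursive_rec (G : nat -> nat -> nat -> nat) (b k : nat -> nat) :
  recursive (fun m => G (unpair m).1 (unpair (unpair m).2).1
                        (unpair (unpair m).2).2) ->
  recursive b -> recursive k ->
  recursive (fun n => nat_rec (fun=> nat) (b n) (G n) (k n)).
Proof.
move=> [cG GP] [cb bP] rk.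
pose F m := nat_rec (fun=> nat) (b (unpair m).1) (G (unpair m).1) (unpair m).2.
suff rF : recursive F.
  apply: recursive_ext _ (recursive_comp rF (recursive_cpair recursive_id rk)).
  by move=> n; rewrite /F cpairK.
exists (Prec cb cG) => phi m; rewrite -(unpairK m).
case: (unpair m) => {m} n i; rewrite /F cpairK /=.
elim: i => [|i IHi] /=; first by constructor.
apply: eval_PrecS IHi _; set a := nat_rec _ _ _ _.
by have := GP phi (cpair n (cpair i a)); rewrite /= !cpairK.
Qed.

Lemma recursive_add f g :
  recursive f -> recursive g -> recursive (fun n => f n + g n)%N.
Proof.
move=> rf rg; apply: recursive_ext _ (@recursive_rec
  (fun _ _ a => a.+1) f g _ rf rg).
  by move=> n; elim: (g n) => [|k /= ->]; rewrite ?addn0 ?addnS.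
by apply: recursive_S; do 2!apply: recursive_snd; apply: recursive_id.
Qed.

Lemma recursive_mul f g :
  recursive f -> recursive g -> recursive (fun n => f n * g n)%N.
Proof.
move=> rf rg.
apply: recursive_ext _ (@recursive_rec (fun n _ a => f n + a)%N
  (fun=> 0%N) g _ (recursive_const _) rg).
  by move=> n; elim: (g n) => [|k /= ->]; rewrite ?muln0 ?mulnS.
apply: recursive_add; last by do 2!apply: recursive_snd; apply: recursive_id.
by apply: recursive_comp rf _; apply: recursive_fst; apply: recursive_id.
Qed.

Lemma recursive_sub f g :
  recursive f -> recursive g -> recursive (fun n => f n - g n)%N.
Proof.
(* The predecessor is the recursion that returns its counter and forgets the accumulated value. *)
have rP : recursive predn.
  apply: recursive_ext _ (@recursive_rec (fun _ i _ => i)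
    (fun=> 0%N) id _ (recursive_const _) recursive_id); first by case.
  by apply: recursive_fst; apply: recursive_snd; apply: recursive_id.
move=> rf rg; apply: recursive_ext _ (@recursive_rec
  (fun _ _ a => a.-1) f g _ rf rg).
  by move=> n; elim: (g n) => [|k /= ->]; rewrite ?subn0 ?subnS.
by apply: recursive_comp rP _; do 2!apply: recursive_snd; apply: recursive_id.
Qed.

Lemma recursive_exp2 f : recursive f -> recursive (fun n => 2 ^ f n)%N.
Proof.
move=> rf; apply: recursive_ext _ (@recursive_rec (fun _ _ a => a + a)%N
  (fun=> 1%N) f _ (recursive_const _) rf).
  by move=> n; elim: (f n) => [|k /= ->]; rewrite ?expn0 ?expnS ?mul2n ?addnn.
by apply: recursive_add; do 2!apply: recursive_snd; apply: recursive_id.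
Qed.

Lemma recursive_sum (F : nat -> nat -> nat) k :
  recursive (fun m => F (unpair m).1 (unpair m).2) -> recursive k ->
  recursive (fun n => \sum_(i < k n) F n i)%N.
Proof.
move=> rF rk.
apply: recursive_ext _ (@recursive_rec (fun n i a => F n i + a)%N
  (fun=> 0%N) k _ (recursive_const _) rk).
  move=> n; elim: (k n) => [|i /= ->]; first by rewrite big_ord0.
  by rewrite big_ord_recr addnC.
apply: recursive_add; last by do 2!apply: recursive_snd; apply: recursive_id.
apply: recursive_ext _ (recursive_comp rF (recursive_cpair
  (recursive_fst recursive_id)
  (recursive_fst (recursive_snd recursive_id)))).
by move=> m; rewrite cpairK.
Qed.

Lemma recursive_mu f : recursive f ->
  (forall n, exists k, f (cpair n k) = 0%N) ->
  exists2 g, recursive g & forall n, f (cpair n (g n)) = 0%N.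
Proof.
move=> [c cP] f0.
have f0b n : exists k, f (cpair n k) == 0%N by have [k /eqP] := f0 n; exists k.
pose g n := ex_minn (f0b n).
exists g; last by move=> n; rewrite /g; case: ex_minnP => k /eqP.
exists (Mu c) => phi n; rewrite /g; case: ex_minnP => k /eqP fk kmin.
(* [eval_Mu] wants the values before the first zero as successors; they are positive by minimality
   of [k], so their predecessors serve as [h]. *)
apply: (eval_Mu (h := fun i => (f (cpair n i)).-1)); last by rewrite -fk.
move=> i ltik; rewrite prednK // lt0n; apply/negP => /kmin.
by rewrite leqNgt ltik.
Qed.

(** Truth is encoded by 0, so that conjunction is a sum, disjunction a product, and [Mu] searches
    for a true instance. *)
Definition decidable_pred (P : nat -> Prop) : Prop :=
  exists2 f, recursive f & forall n, P n <-> f n = 0%N.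

Lemma decidable_ext P Q :
  (forall n, P n <-> Q n) -> decidable_pred P -> decidable_pred Q.
Proof. by move=> PQ [f rf fP]; exists f => // n; rewrite -PQ. Qed.

Lemma decidable_comp P g :
  decidable_pred P -> recursive g -> decidable_pred (fun n => P (g n)).
Proof.
by move=> [f rf fP] rg; exists (fun n => f (g n)) => //; apply: recursive_comp.
Qed.

Lemma decidable_eq f g :
  recursive f -> recursive g -> decidable_pred (fun n => f n = g n).
Proof.
move=> rf rg; exists (fun n => (f n - g n) + (g n - f n))%N.
  by apply: recursive_add; apply: recursive_sub.
move=> n; split=> [->|/eqP]; first by rewrite subnn.
by rewrite addn_eq0 !subn_eq0 -eqn_leq => /eqP.
Qed.

Lemma decidable_lt f g :
  recursive f -> recursive g -> decidable_pred (fun n => (f n < g n)%N).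
Proof.
move=> rf rg; exists (fun n => (f n).+1 - g n)%N.
  by apply: recursive_sub => //; apply: recursive_S.
by move=> n; rewrite -subn_eq0; split=> /eqP.
Qed.

Lemma decidable_not P : decidable_pred P -> decidable_pred (fun n => ~ P n).
Proof.
move=> [f rf fP]; exists (fun n => 1 - f n)%N.
  by apply: recursive_sub => //; apply: recursive_const.
by move=> n; rewrite fP; case: (f n) => //; split.
Qed.

Lemma decidable_and P Q : decidable_pred P -> decidable_pred Q ->
  decidable_pred (fun n => P n /\ Q n).
Proof.
move=> [f rf fP] [g rg gP]; exists (fun n => f n + g n)%N.
  exact: recursive_add.
by move=> n; rewrite fP gP; case: (f n) => [|?]; split=> // -[].
Qed.

Lemma decidable_or P Q : decidable_pred P -> decidable_pred Q ->
  decidable_pred (fun n => P n \/ Q n).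
Proof.
move=> [f rf fP] [g rg gP]; exists (fun n => f n * g n)%N.
  exact: recursive_mul.
move=> n; rewrite fP gP; split=> [[] ->|/eqP]; rewrite ?muln0 //.
by rewrite muln_eq0 => /orP[] /eqP; [left|right].
Qed.

Ltac recursive_step := first
  [ apply: recursive_const | apply: recursive_id | apply: recursive_fst
  | apply: recursive_snd | apply: recursive_S | apply: recursive_cpair
  | apply: recursive_add | apply: recursive_sub | apply: recursive_mul
  | apply: recursive_exp2 ].
Ltac prove_recursive := repeat recursive_step.

(** * An undecidable semidecidable set *)

Fixpoint code_number (c : code) : nat :=
  match c with
  | Zero => cpair 0 0
  | Succ => cpair 1 0
  | Fst => cpair 2 0
  | Snd => cpair 3 0
  | Oracle => cpair 4 0
  | Pair f g => cpair 5 (cpair (code_number f) (code_number g))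
  | Comp f g => cpair 6 (cpair (code_number f) (code_number g))
  | Prec f g => cpair 7 (cpair (code_number f) (code_number g))
  | Mu f => cpair 8 (code_number f)
  end.

Definition judgment (e n v : nat) : nat := cpair e (cpair n v).

(* The rules of [eval (fun=> 0)], read on numbers: [Q] is the set of available
   premises, and the disjuncts follow the order of the constructors. The premise
   of [Mu] is written with [~ exists _, ~ _], the form in which quantifiers are
   shown to preserve decidability. *)
Definition inference (Q : nat -> Prop) (x : nat) : Prop :=
  let e := (unpair x).1 in
  let f := (unpair (unpair e).2).1 in
  let g := (unpair (unpair e).2).2 in
  let n := (unpair (unpair x).2).1 in
  let v := (unpair (unpair x).2).2 in
  ((unpair e).1 = 0%N /\ v = 0%N) \/
  ((unpair e).1 = 1%N /\ v = n.+1) \/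
  ((unpair e).1 = 2%N /\ v = (unpair n).1) \/
  ((unpair e).1 = 3%N /\ v = (unpair n).2) \/
  ((unpair e).1 = 4%N /\ v = 0%N) \/
  ((unpair e).1 = 5%N /\ Q (judgment f n (unpair v).1) /\
     Q (judgment g n (unpair v).2)) \/
  ((unpair e).1 = 6%N /\ exists a, Q (judgment g n a) /\ Q (judgment f a v)) \/
  ((unpair e).1 = 7%N /\ (unpair n).2 = 0%N /\
     Q (judgment f (unpair n).1 v)) \/
  ((unpair e).1 = 7%N /\ exists k, (unpair n).2 = k.+1 /\
     exists a, Q (judgment e (cpair (unpair n).1 k) a) /\
       Q (judgment g (cpair (unpair n).1 (cpair k a)) v)) \/
  ((unpair e).1 = 8%N /\
     (~ exists i, (i < v)%N /\
        ~ exists h, Q (judgment (unpair e).2 (cpair n i) h.+1)) /\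
     Q (judgment (unpair e).2 (cpair n v) 0)).

Lemma inference_mono (Q Q' : nat -> Prop) x :
  (forall y, Q y -> Q' y) -> inference Q x -> inference Q' x.
Proof.
rewrite /inference => QQ'.
case=> [?|]; first by left.
case=> [?|]; first by right; left.
case=> [?|]; first by do 2!right; left.
case=> [?|]; first by do 3!right; left.
case=> [?|]; first by do 4!right; left.
case=> [[? [? ?]]|]; first by do 5!right; left; split=> //; split; apply: QQ'.
case=> [[? [a [? ?]]]|].
  by do 6!right; left; split=> //; exists a; split; apply: QQ'.
case=> [[? [? ?]]|].
  by do 7!right; left; split=> //; split=> //; apply: QQ'.
case=> [[? [k [? [a [? ?]]]]]|].
  do 8!right; left; split=> //; exists k; split=> //; exists a.
  by split; apply: QQ'.
move=> [? [Qh Q0]]; do 9!right; split=> //; split; last exact: QQ'.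
move=> [i [lti nh]]; apply: Qh; exists i; split=> // -[h Qh]; apply: nh.
by exists h; apply: QQ'.
Qed.

(** Premises stand strictly later in the list than their conclusion, which makes derivations well
    founded and stable under concatenation. *)
Fixpoint derivation (ds : seq nat) : Prop :=
  if ds is x :: ds' then inference (fun y => y \in ds') x /\ derivation ds'
  else True.

Lemma derivation_cat ds1 ds2 :
  derivation ds1 -> derivation ds2 -> derivation (ds1 ++ ds2).
Proof.
move=> d1 d2; elim: ds1 d1 => //= x ds1 IH [ix /IH ?]; split=> //.
by apply: inference_mono ix => y; rewrite mem_cat => ->.
Qed.

Lemma eval_derivation c n v : eval (fun=> 0%N) c n v ->
  exists2 ds, derivation ds & judgment (code_number c) n v \in ds.
Proof.
have close ds c' n' v' : derivation ds ->
  inference (fun y => y \in ds) (judgment (code_number c') n' v') ->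
  exists2 ds, derivation ds & judgment (code_number c') n' v' \in ds.
  by move=> dds ix; exists (judgment (code_number c') n' v' :: ds);
    rewrite ?inE ?eqxx.
elim=> {c n v} [n|n|n|n|n|f g n a b _ [d1 dd1 i1] _ [d2 dd2 i2]
  |f g n a b _ [d1 dd1 i1] _ [d2 dd2 i2]|f g n a _ [d1 dd1 i1]
  |f g n k a b _ [d1 dd1 i1] _ [d2 dd2 i2]
  |f n k h _ IHh _ [d2 dd2 i2]].
- by apply: (close [::]) => //; left; rewrite /judgment !cpairK.
- by apply: (close [::]) => //; right; left; rewrite /judgment !cpairK.
- by apply: (close [::]) => //; do 2!right; left; rewrite /judgment !cpairK.
- by apply: (close [::]) => //; do 3!right; left; rewrite /judgment !cpairK.
- by apply: (close [::]) => //; do 4!right; left; rewrite /judgment !cpairK.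
- apply: (close (d1 ++ d2)); first exact: derivation_cat.
  do 5!right; left; rewrite /judgment !(cpairK, mem_cat) /= ?cpairK /=.
  by rewrite -!/(judgment _ _ _) i1 i2 orbT.
- apply: (close (d1 ++ d2)); first exact: derivation_cat.
  do 6!right; left; rewrite /judgment !cpairK /= ?cpairK /=; split=> //; exists a.
  by rewrite -!/(judgment _ _ _) !mem_cat i1 i2 orbT.
- apply: (close d1) => //.
  by do 7!right; left; rewrite /judgment !cpairK /= ?cpairK /=.
- apply: (close (d1 ++ d2)); first exact: derivation_cat.
  do 8!right; left; rewrite /judgment !cpairK /= ?cpairK /=; split=> //.
  exists k; split=> //; exists a.
  by rewrite -!/(judgment _ _ _) !mem_cat i1 i2 orbT.
(* The rule for [Mu] has [k] positive premises; their derivations are concatenated by induction on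
   [k]. *)
have [d1 dd1 i1] : exists2 ds, derivation ds & forall i, (i < k)%N ->
    judgment (code_number f) (cpair n i) (h i).+1 \in ds.
  elim: (k) IHh => [|j IHj] IHh; first by exists [::].
  have [i ltij|d1 dd1 i1] := IHj; first by apply: IHh; rewrite ltnS ltnW.
  have [d3 dd3 i3] := IHh j (ltnSn j).
  exists (d1 ++ d3); first exact: derivation_cat.
  move=> i; rewrite ltnS mem_cat leq_eqVlt => /orP[/eqP->|/i1->//].
  by rewrite i3 orbT.
apply: (close (d1 ++ d2)); first exact: derivation_cat.
do 9!right; rewrite /judgment !cpairK /=; split=> //.
rewrite -!/(judgment _ _ _) !mem_cat i2 orbT; split=> //.
move=> [i [/i1 ii]]; apply; exists (h i).
by rewrite mem_cat ii.
Qed.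

(** Lists are nested pairs ending in 0. As 0 is itself [cpair 0 0], reading past the end gives 0, so
    the length has to be recorded separately. *)
Definition entry (s i : nat) : nat :=
  (unpair (nat_rec (fun=> nat) s (fun _ a => (unpair a).2) i)).1.

(** The existence of a derivation containing [x], arithmetized: [s] codes the list and [l] is its
    length. Only existential quantifiers and negations occur, as in [inference]. *)
Definition derivable (x : nat) : Prop :=
  exists s l, (exists i, (i < l)%N /\ entry s i = x) /\
    ~ exists i, (i < l)%N /\
      ~ inference (fun y => exists j, (i < j)%N /\ (j < l)%N /\ entry s j = y)
          (entry s i).

Lemma entry_foldr ds i : entry (foldr cpair 0%N ds) i = nth 0%N ds i.
Proof.
have -> : entry (foldr cpair 0%N ds) i =
      (unpair (foldr cpair 0%N (drop i ds))).1.
  rewrite /entry; congr (unpair _).1; elim: i => [|i /= ->]; rewrite ?drop0 //.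
  rewrite -add1n -drop_drop; case: (drop i ds) => //= x t; rewrite cpairK.
  by rewrite drop0.
case: (ltnP i (size ds)) => lti; last by rewrite drop_oversize // nth_default.
by rewrite (drop_nth 0%N) //= cpairK.
Qed.

Lemma derivation_derivable ds x : derivation ds -> x \in ds -> derivable x.
Proof.
move=> dds xds; exists (foldr cpair 0%N ds), (size ds); split.
  by exists (index x ds); rewrite index_mem entry_foldr nth_index.
move=> [i [lti]]; apply; rewrite entry_foldr.
elim: ds i lti dds {xds} => //= y ds IH [|i] /= lti [iy dds].
  apply: inference_mono iy => z zds; exists (index z ds).+1.
  by rewrite (entry_foldr (y :: ds)) /= nth_index // !ltnS index_mem.
apply: inference_mono (IH i lti dds) => z [j [ltij [ltj e]]].
by exists j.+1; rewrite !ltnS (entry_foldr (y :: ds)) /= -entry_foldr.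
Qed.

(** A list may contain entries that are no judgments about codes, but the premises of a judgment
    about a code are again about codes, so rules can be read back from this entry on. *)
Lemma derivable_eval c n v :
  derivable (judgment (code_number c) n v) -> eval (fun=> 0%N) c n v.
Proof.
move=> [s [l [[i [lti ei]] hinf]]].
have {}hinf j : (j < l)%N -> inference
    (fun y => exists k, (j < k)%N /\ (k < l)%N /\ entry s k = y) (entry s j).
  by move=> ltj; apply: contrapT => ninf; apply: hinf; exists j.
(* Premises have larger indices, so the distance to the end of the list decreases. *)
have [m] := ubnP (l - i); elim: m i c n v lti ei => // m IH i c n v lti ei lem.
have {IH} IH e c' n' v' : e = code_number c' ->
    (exists k, (i < k)%N /\ (k < l)%N /\ entry s k = judgment e n' v') ->
    eval (fun=> 0%N) c' n' v'.
  move=> -> [k [ltik [ltkl ek]]]; apply: (IH k) => //.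
  by apply: leq_trans (ltn_sub2l _ ltik) _.
have := hinf _ lti; rewrite ei /inference.
have -> : unpair (judgment (code_number c) n v) = (code_number c, cpair n v).
  exact: cpairK.
rewrite /fst /snd cpairK.
case: c {ei} => [|||||f g|f g|f g|f]; rewrite [code_number _]/= ?cpairK /=.
- by case=> [[_ ->]|]; [exact: eval_Zero|do 8![case=> [[//]|]]; case].
- by case=> [[//]|]; case=> [[_ ->]|];
  [exact: eval_Succ|do 7![case=> [[//]|]]; case].
- by do 2![case=> [[//]|]]; case=> [[_ ->]|];
  [exact: eval_Fst|do 6![case=> [[//]|]]; case].
- by do 3![case=> [[//]|]]; case=> [[_ ->]|];
  [exact: eval_Snd|do 5![case=> [[//]|]]; case].
- by do 4![case=> [[//]|]]; case=> [[_ ->]|];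
  [exact: eval_Oracle|do 4![case=> [[//]|]]; case].
- do 5![case=> [[//]|]]; case=> [[_ [H1 H2]]|].
    by rewrite -(unpairK v); apply: eval_Pair; apply: IH; eauto.
  by do 3![case=> [[//]|]]; case.
- do 6![case=> [[//]|]]; case=> [[_ [a [H1 H2]]]|].
    by apply: eval_Comp; apply: IH; eauto.
  by do 2![case=> [[//]|]]; case.
- do 7![case=> [[//]|]]; case=> [[_ [n0 H1]]|].
    have {}n0 : (unpair n).2 = 0%N := n0.
    rewrite -(unpairK n) n0; apply: eval_Prec0; exact: IH H1.
  case=> [[_ [k [nk [a [H1 H2]]]]]|[]//].
  have {}nk : (unpair n).2 = k.+1 := nk.
  rewrite -(unpairK n) nk; apply: eval_PrecS; last exact: IH H2.
  exact: IH H1.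
do 9![case=> [[//]|]]; move=> [_ [Hh H0]].
(* Choice collects the premises of [Mu] into one function; where no premise is available, which
   excludes [i' < v], the value 0 is a dummy. *)
have /choice[h hP] i' : exists h, (i' < v)%N ->
    eval (fun=> 0%N) f (cpair n i') h.+1.
  case: (pselect (exists h, exists k, (i < k)%N /\ (k < l)%N /\
      entry s k = judgment (code_number f) (cpair n i') h.+1)) => [[h Qh]|nh].
    by exists h => _; apply: IH Qh.
  by exists 0%N => lt; case: Hh; exists i'.
by apply: (eval_Mu hP); apply: IH H0.
Qed.
(* If no semidecidable set were undecidable, the decidable sets would be closed
   under quantifiers, hence [derivable] would be decidable and could be
   diagonalized against. *)
Lemma undecidable_semidecidable : exists f, recursive f /\
  ~ decidable_pred (fun n => exists k, f (cpair n k) = 0%N).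
Proof.
apply: contrapT => noun.
have decE (P : nat -> nat -> Prop) :
    decidable_pred (fun m => P (unpair m).1 (unpair m).2) ->
    decidable_pred (fun n => exists k, P n k).
  move=> [f rf fP]; case: (pselect (decidable_pred
      (fun n => exists k, f (cpair n k) = 0%N))) => [|nd].
    by apply: decidable_ext => n; split=> -[k fk]; exists k; move: fk;
      rewrite -fP cpairK.
  by case: noun; exists f.
have [f rf fP] : decidable_pred
    (fun n => ~ derivable (judgment n n 0)).
  apply: decidable_not.
  suff dd : decidable_pred derivable.
    by apply: decidable_comp dd _; rewrite /judgment; prove_recursive.
  have rentry s i : recursive s -> recursive i ->
      recursive (fun n => entry (s n) (i n)).
    move=> rs ri; rewrite /entry; apply: recursive_fst.
    apply: (recursive_rec (G := fun _ _ a => (unpair a).2)) => //.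
    by prove_recursive.
  have dQ (i l s y : nat -> nat) : recursive i -> recursive l -> recursive s ->
      recursive y -> decidable_pred (fun n =>
        exists j, (i n < j)%N /\ (j < l n)%N /\ entry (s n) j = y n).
    move=> ri rl rs ry.
    have rfst g : recursive g -> recursive (fun m => g (unpair m).1).
      by move=> rg; apply: recursive_comp rg _; prove_recursive.
    apply: (decE); apply: decidable_and; first by
      apply: decidable_lt; [exact: rfst|prove_recursive].
    apply: decidable_and; first by
      apply: decidable_lt; [prove_recursive|exact: rfst].
    by apply: decidable_eq; [apply: (rentry)|apply: (rfst)] => //;
      [exact: rfst|prove_recursive].
  rewrite /derivable; do 2!apply: (decE).
  apply: decidable_and.
    apply: (decE); apply: decidable_and.
      by apply: decidable_lt; prove_recursive.
    by apply: decidable_eq; [apply: (rentry)|]; prove_recursive.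
  apply: decidable_not; apply: (decE); apply: decidable_and.
    by apply: decidable_lt; prove_recursive.
  apply: decidable_not; rewrite /inference /judgment.
  repeat first [apply: decidable_or | apply: decidable_and | apply: (dQ)
    | apply: decidable_not | apply: (decE) | apply: decidable_eq
    | apply: decidable_lt | apply: (rentry) | recursive_step].
(* Diagonalization: [c] run on its own number returns 0 exactly if that fact is derivable, whereas
   [f] was chosen to vanish exactly if it is not. *)
have [c cP] := rf; pose n := code_number c.
have dn : derivable (judgment n n 0) <-> f n = 0%N.
  split=> [/derivable_eval ev|fn].
    exact: Defs.eval_functional (cP _ _) ev.
  have := cP (fun=> 0%N) n; rewrite fn => /eval_derivation[ds].
  exact: derivation_derivable.
by have := fP n; rewrite -dn; tauto.
Qed.

(** A unique stage per element gives each fjord a single width. Adding to [f] a penalty for every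
    earlier zero leaves only the first zero. *)
Lemma undecidable_first_stage : exists f, [/\ recursive f,
  (forall n k k', f (cpair n k) = 0%N -> f (cpair n k') = 0%N -> k = k') &
  ~ decidable_pred (fun n => exists k, f (cpair n k) = 0%N)].
Proof.
have [f [rf nd]] := undecidable_semidecidable.
pose g m := (f m + \sum_(i < (unpair m).2) (1 - f (cpair (unpair m).1 i)))%N.
have gE n k : g (cpair n k) = 0%N <->
    f (cpair n k) = 0%N /\ forall i, (i < k)%N -> f (cpair n i) != 0%N.
  rewrite /g cpairK /=; split=> [/eqP|[-> nf]]; last first.
    rewrite add0n big1// => -[i lti] _ /=; apply/eqP.
    by rewrite subn_eq0 lt0n nf.
  rewrite addn_eq0 sum_nat_eq0 => /andP[/eqP-> /forallP z]; split=> // i lti.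
  by have := z (Ordinal lti); rewrite /= subn_eq0 lt0n.
exists g; split.
- apply: recursive_add => //.
  apply: (recursive_sum (F := fun m i => 1 - f (cpair (unpair m).1 i))%N);
    last by prove_recursive.
  apply: recursive_sub; first exact: recursive_const.
  by apply: recursive_comp rf _; prove_recursive.
- move=> n k k' /gE[fk nk] /gE[fk' nk'].
  case: (ltngtP k k') => // [/nk'|/nk]; last by rewrite fk'.
  by rewrite fk.
apply: contra_not nd; apply: decidable_ext => n.
split=> -[k fk]; first by exists k; case/gE: fk.
have exk : exists k, f (cpair n k) == 0%N by exists k; apply/eqP.
exists (ex_minn exk); case: ex_minnP => i /eqP fi imin; apply/gE; split=> // j.
by move=> ltj; apply/negP => /imin; rewrite leqNgt ltj.
Qed.

(* [internalize q c] run on [(k, n)] simulates [c] run on [n] with the constant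
   oracle computed by [q] from [k]. *)
Fixpoint internalize (q c : Defs.code) : Defs.code :=
  match c with
  | Zero => Zero
  | Succ => Comp Succ Snd
  | Fst => Comp Fst Snd
  | Snd => Comp Snd Snd
  | Oracle => Comp q Fst
  | Pair f g => Pair (internalize q f) (internalize q g)
  | Comp f g => Comp (internalize q f) (Pair Fst (internalize q g))
  | Prec f g =>
      Comp (Prec (internalize q f)
        (Comp (internalize q g)
           (Pair (Comp Fst Fst) (Pair (Comp Snd Fst) Snd))))
        (Pair (Pair Fst (Comp Fst Snd)) (Comp Snd Snd))
  | Mu f =>
      Mu (Comp (internalize q f) (Pair (Comp Fst Fst) (Pair (Comp Snd Fst) Snd)))
  end.

(** A modulus will be evaluated only at dyadic points, where a constant oracle is exact. Computing
    that constant from [k] turns an oracle computation into a recursive function of [k] and the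
    precision. *)
Lemma eval_internalize q (Q : nat -> nat) (k : nat) c n v phi :
  (forall psi k, Defs.eval psi q k (Q k)) ->
  Defs.eval (fun=> Q k) c n v -> Defs.eval phi (internalize q c) (cpair k n) v.
Proof.
move=> qQ.
have evF psi a b : Defs.eval psi Fst (cpair a b) a.
  by have := eval_Fst psi (cpair a b); rewrite cpairK.
have evS psi a b : Defs.eval psi Snd (cpair a b) b.
  by have := eval_Snd psi (cpair a b); rewrite cpairK.
have assoc psi a b d : Defs.eval psi
    (Pair (Comp Fst Fst) (Pair (Comp Snd Fst) Snd)) (cpair (cpair a b) d)
    (cpair a (cpair b d)).
  by apply: eval_Pair; [|apply: eval_Pair] => //; apply: eval_Comp.
elim=> {c n v} [n|n|n|n|n|f g n a b _ IHa _ IHb|f g n a b _ IHa _ IHb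
  |f g n a _ IHa|f g n i a b _ IHa _ IHb|f n i h _ IHh _ IHi] /=.
- exact: eval_Zero.
- exact: eval_Comp (evS _ _ _) (eval_Succ _ _).
- exact: eval_Comp (evS _ _ _) (eval_Fst _ _).
- exact: eval_Comp (evS _ _ _) (eval_Snd _ _).
- exact: eval_Comp (evF _ _ _) (qQ _ _).
- exact: eval_Pair.
- by apply: eval_Comp IHb; apply: eval_Pair.
- apply: (eval_Comp (a := cpair (cpair k n) 0)); last exact: eval_Prec0.
  by apply: eval_Pair; [apply: eval_Pair|] => //; apply: eval_Comp.
- apply: (eval_Comp (a := cpair (cpair k n) i.+1)).
    by apply: eval_Pair; [apply: eval_Pair|] => //; apply: eval_Comp.
  (* The induction hypothesis concerns the composite with the repacking; inversion exposes the
     recursion itself, and functionality identifies its repacked argument. *)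
  inversion IHa; subst.
  move: H4; rewrite (Defs.eval_functional (v := cpair (cpair k n) i) H1).
    move=> evi; apply: eval_PrecS evi _.
    exact: eval_Comp (assoc _ _ _ _) IHb.
  by apply: eval_Pair; [apply: eval_Pair|] => //; apply: eval_Comp.
apply: (eval_Mu (h := h)) => [j ltj|].
  by apply: eval_Comp (IHh j ltj).
by apply: eval_Comp IHi.
Qed.
(** * The domain *)

Lemma cvg_mkpair (R : realType) (U : Type) (F : set_system U) (FF : Filter F)
    (f g : U -> R) (a b : R) :
  f x @[x --> F] --> a -> g x @[x --> F] --> b ->
  (f x, g x) @[x --> F] --> (a, b).
Proof. by move=> fa gb; apply: (cvg_pair fa gb). Qed.

Section Fjords.
Variables (R : realType) (T : nat -> nat -> bool).
Hypothesis T_functional : forall n t t', T n t -> T n t' -> t = t'.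

Definition tip (n : nat) : R := 2 ^- n.+1.

(** A tent over [tip n] of height 2^-(n+3); its slope 2^(t+1) makes the half-width 2^-(n+t+4). *)
Definition bump (n t : nat) (x : R) : R :=
  Num.max 0 (tip n / 4 - 2 ^+ t.+1 * `|x - tip n|).

(** The tents have disjoint supports, so at most one fjord matters at [x]. If there is none, the
    default (0, 0) gives 0 in both branches: either [T 0 0] fails or [bump 0 0 x] is not
    positive. *)
Definition depth (x : R) : R :=
  let p := xget (0%N, 0%N) [set p | T p.1 p.2 /\ 0 < bump p.1 p.2 x] in
  if T p.1 p.2 then bump p.1 p.2 x else 0.

Definition height (x : R) : R := 1 - depth x.

Definition fjord_domain : set (R * R) :=
  [set z | (0 < z.1 < 1) /\ (0 < z.2 < height z.1)].

Definition fjord_closure : set (R * R) :=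
  [set z | (0 <= z.1 <= 1) /\ (0 <= z.2 <= height z.1)].

Lemma tip_gt0 n : 0 < tip n.
Proof. by rewrite invr_gt0 exprn_gt0. Qed.

Lemma tipS n : tip n = 2 * tip n.+1.
Proof. by rewrite /tip [in RHS]exprS invfM mulrA divff// mul1r. Qed.

Lemma tip0 : tip 0 = 1 / 2.
Proof. by rewrite /tip expr1 div1r. Qed.

Lemma tip_le m n : (m <= n)%N -> tip n <= tip m.
Proof.
move=> lemn; rewrite lef_pV2 ?posrE ?exprn_gt0//.
by rewrite ler_eXn2l// ?ltr1n// ltnS.
Qed.

Lemma tip_lt m n : (m < n)%N -> 2 * tip n <= tip m.
Proof. by move=> ltmn; rewrite (tipS m) ler_pM2l// tip_le. Qed.

Lemma tip_le_half n : tip n <= 1 / 2.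
Proof. by rewrite -tip0 tip_le. Qed.

Lemma tip_small (e : R) : 0 < e -> exists N, forall n, (N <= n)%N -> tip n < e.
Proof.
move=> e0; have [N ltN] : exists N, tip N < e.
  exists (Num.truncn e^-1); rewrite /tip -[ltRHS]invrK ltf_pV2 ?posrE ?exprn_gt0//;
    last by rewrite invr_gt0.
  have le0 : 0 <= e^-1 by rewrite invr_ge0 ltW.
  have /andP[_ lt] := truncn_itv le0; apply: lt_le_trans lt _.
  by rewrite -natrX ler_nat; apply: ltnW; apply: ltn_expl.
by exists N => n /tip_le le; apply: le_lt_trans le ltN.
Qed.

Lemma bump_ge0 n t x : 0 <= bump n t x.
Proof. by rewrite le_max lexx. Qed.

Lemma bump_le n t x : bump n t x <= tip n / 4.
Proof.
have := tip_gt0 n => t0; rewrite ge_max; apply/andP; split; first lra.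
have : 0 <= 2 ^+ t.+1 * `|x - tip n| by rewrite mulr_ge0 ?exprn_ge0.
by lra.
Qed.

Lemma bump_tip n t : bump n t (tip n) = tip n / 4.
Proof.
rewrite /bump subrr normr0 mulr0 subr0; apply/max_idPr.
by have := tip_gt0 n; lra.
Qed.

Lemma exp2_ge2 t : 2 <= 2 ^+ t.+1 :> R.
Proof. by rewrite exprS ler_peMr// exprn_ege1// ler1n. Qed.

Lemma bump_gt0 n t x : 0 < bump n t x -> `|x - tip n| < tip n / 8.
Proof.
rewrite lt_max ltxx /= subr_gt0 => lt; have := exp2_ge2 t.
have := normr_ge0 (x - tip n); move: lt; set a := `|_|; set b := _ ^+ _ => ? ? ?.
nra.
Qed.

Lemma bump_lipschitz n t x y :
  bump n t x <= bump n t y + 2 ^+ t.+1 * `|x - y|.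
Proof.
have e0 : 0 <= 2 ^+ t.+1 :> R by rewrite exprn_ge0.
rewrite ge_max; apply/andP; split.
  by apply: addr_ge0; rewrite ?bump_ge0 ?mulr_ge0.
have lb : tip n / 4 - 2 ^+ t.+1 * `|y - tip n| <= bump n t y.
  by rewrite le_max lexx orbT.
have tri : `|y - tip n| <= `|x - tip n| + `|x - y|.
  have -> : y - tip n = (x - tip n) - (x - y) by ring.
  exact: ler_normB.
by have := ler_wpM2l e0 tri; lra.
Qed.

(** Distinct tips differ by a factor of at least 2, while a tent reaches at most an eighth of its
    tip to either side, its slope being at least 2. *)
Lemma bump_disjoint n t n' t' x :
  0 < bump n t x -> 0 < bump n' t' x -> n = n'.
Proof.
move=> /bump_gt0 + /bump_gt0; rewrite !ltr_norml => h h'.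
have := tip_gt0 n; have := tip_gt0 n'.
by case: (ltngtP n n') => // /tip_lt ? ? ?; exfalso; lra.
Qed.

Lemma depth_bump n t x : T n t -> 0 < bump n t x -> depth x = bump n t x.
Proof.
move=> Tnt b0; rewrite /depth; set P := [set p | _]; set p := xget _ P.
have [Tp bp] : P p by apply: xgetPex; exists (n, t).
have en := bump_disjoint bp b0.
by rewrite Tp; move: Tp; rewrite en => /(T_functional Tnt) <-.
Qed.

Lemma depth_cases x :
  (depth x = 0 /\ forall n t, T n t -> bump n t x = 0) \/
  exists n t, [/\ T n t, 0 < bump n t x & depth x = bump n t x].
Proof.
case: (pselect (exists n t, T n t /\ 0 < bump n t x)) => [[n [t [Tnt b0]]]|nb].
  by right; exists n, t; split=> //; apply: depth_bump.
have z n t : T n t -> bump n t x = 0.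
  move=> Tnt; apply/eqP; rewrite eq_le bump_ge0 andbT leNgt; apply/negP => b0.
  by apply: nb; exists n, t.
by left; split=> //; rewrite /depth; case: ifP => // /z.
Qed.

Lemma depth_ge0 x : 0 <= depth x.
Proof. by rewrite /depth; case: ifP => // _; rewrite bump_ge0. Qed.

Lemma depth_ge n t x : T n t -> bump n t x <= depth x.
Proof.
move=> Tnt; have [b0|b0] := ltrP 0 (bump n t x).
  by rewrite (depth_bump Tnt b0).
exact: le_trans b0 (depth_ge0 x).
Qed.

Lemma depth_le x : depth x <= 1 / 8.
Proof.
case: (depth_cases x) => [[-> _]|[n [t [_ _ ->]]]]; first lra.
by apply: le_trans (bump_le _ _ _) _; have := tip_le_half n; lra.
Qed.

(** A fjord over [x] has its tip below 8x/7 and a depth of at most a quarter of that. This leaves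
    room at the left edge, where the fjords accumulate. *)
Lemma depth_le_id x : 0 <= x -> depth x <= x.
Proof.
move=> x0; case: (depth_cases x) => [[-> _]//|[n [t [_ b0 ->]]]].
have := bump_le n t x; have := bump_gt0 b0; rewrite ltr_norml.
by have := tip_gt0 n; lra.
Qed.

Lemma depth_near_one x : 3 / 4 <= x -> depth x = 0.
Proof.
move=> x0; case: (depth_cases x) => [[-> _]//|[n [t [_ b0 ->]]]].
have := bump_gt0 b0; rewrite ltr_norml.
by have := tip_gt0 n; have := tip_le_half n; lra.
Qed.

(** The slopes are unbounded over all fjords. But those of index at least [N] are shallower than
    [e], and the finitely many others, each with a unique stage, have a common slope bound [L]. *)
Lemma depth_uniform (e : R) : 0 < e -> exists2 d : R, 0 < d &
  forall x y, `|x - y| < d -> depth x <= depth y + e.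
Proof.
move=> e0; have [N smallN] := tip_small e0.
have [L L0 LP] : exists2 L : R, 0 < L &
    forall n t, (n < N)%N -> T n t -> 2 ^+ t.+1 <= L.
  elim: N {smallN} => [|N [L L0 LP]]; first by exists 1.
  case: (pselect (exists t, T N t)) => [[s TNs]|nT].
    exists (L + 2 ^+ s.+1) => [|n t]; first by rewrite addr_gt0 ?exprn_gt0.
    have s0 : 0 <= 2 ^+ s.+1 :> R by rewrite exprn_ge0.
    rewrite ltnS leq_eqVlt => /orP[/eqP-> TNt|lt Tnt].
      by rewrite (T_functional TNs TNt); lra.
    by have := LP _ _ lt Tnt; lra.
  exists L => // n t; rewrite ltnS leq_eqVlt => /orP[/eqP-> TNt|]; last exact: LP.
  by case: nT; exists t.
exists (e / L) => [|x y]; first exact: divr_gt0.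
rewrite ltr_pdivlMr// => lt; have dy := depth_ge0 y.
case: (depth_cases x) => [[-> _]|[n [t [Tnt _ ->]]]]; first lra.
have [ltnN|leNn] := ltnP n N; last first.
  by have := smallN _ leNn; have := bump_le n t x; have := tip_gt0 n; lra.
have := bump_lipschitz n t x y; have := depth_ge y Tnt.
have := ler_wpM2r (normr_ge0 (x - y)) (LP _ _ ltnN Tnt); lra.
Qed.

Lemma depth_continuous : continuous depth.
Proof.
move=> x; apply/cvgrPdist_lt => e e0.
have e20 : 0 < e / 2 by lra.
have [d d0 dP] := depth_uniform e20.
apply: filterS (nbhsx_ballx x _ d0) => y; rewrite /ball /= => dxy.
rewrite ltr_norml; have := dP _ _ dxy; rewrite distrC in dxy.
by have := dP _ _ dxy; lra.
Qed.

Lemma height_continuous : continuous height.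
Proof.
by move=> x; apply: cvgB; [exact: cvg_cst|exact: depth_continuous].
Qed.

Lemma height_bounds x : 7 / 8 <= height x <= 1.
Proof. by rewrite /height; have := depth_le x; have := depth_ge0 x; lra. Qed.

Lemma height_gt0 x : 0 < height x.
Proof. by have := height_bounds x; lra. Qed.

(* [(x, y) |-> (x, y * height x)] is a homeomorphism of the plane carrying the
   unit square onto the domain. *)
Definition shrink (z : R * R) : R * R := (z.1, z.2 * height z.1).
Definition stretch (z : R * R) : R * R := (z.1, z.2 / height z.1).

Lemma shrinkK : cancel shrink stretch.
Proof. by case=> x y; rewrite /stretch /= mulfK// gt_eqF// height_gt0. Qed.

Lemma stretchK : cancel stretch shrink.
Proof. by case=> x y; rewrite /shrink /= divfK// gt_eqF// height_gt0. Qed.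

Lemma shrink_continuous : continuous shrink.
Proof.
move=> z; apply: (@cvg_mkpair _ _ (nbhs z)); first exact: cvg_fst.
apply: cvgM; first exact: cvg_snd.
by apply: continuous_comp; [exact: cvg_fst|exact: height_continuous].
Qed.

Lemma stretch_continuous : continuous stretch.
Proof.
move=> z; apply: (@cvg_mkpair _ _ (nbhs z)); first exact: cvg_fst.
apply: cvgM; first exact: cvg_snd.
apply: cvgV; first by rewrite gt_eqF// height_gt0.
by apply: continuous_comp; [exact: cvg_fst|exact: height_continuous].
Qed.

Definition open_square : set (R * R) :=
  [set z | (0 < z.1 < 1) /\ (0 < z.2 < 1)].
Definition closed_square : set (R * R) :=
  [set z | (0 <= z.1 <= 1) /\ (0 <= z.2 <= 1)].

Lemma fjord_domain_stretch z : fjord_domain z <-> open_square (stretch z).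
Proof.
rewrite /fjord_domain /open_square /=; have h := height_gt0 z.1.
by rewrite pmulr_lgt0 ?invr_gt0// ltr_pdivrMr// mul1r.
Qed.

Lemma fjord_closure_stretch z : fjord_closure z <-> closed_square (stretch z).
Proof.
rewrite /fjord_closure /closed_square /=; have h := height_gt0 z.1.
by rewrite pmulr_lge0 ?invr_gt0// ler_pdivrMr// mul1r.
Qed.

Lemma open_fjord_domain : open fjord_domain.
Proof.
have -> : fjord_domain = stretch @^-1` (fst @^-1` `]0, 1[%classic `&`
    snd @^-1` `]0, 1[%classic).
  apply/seteqP; split=> z /=; rewrite !in_itv /= => ?.
    by apply/fjord_domain_stretch.
  by apply/fjord_domain_stretch.
move/continuousP: stretch_continuous; apply; apply: openI.
  have /continuousP : continuous (@fst R R) by move=> ?; apply: cvg_fst.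
  by apply; exact: interval_open.
have /continuousP : continuous (@snd R R) by move=> ?; apply: cvg_snd.
by apply; exact: interval_open.
Qed.

Lemma closed_fjord_closure : closed fjord_closure.
Proof.
have -> : fjord_closure = stretch @^-1` (fst @^-1` `[0, 1]%classic `&`
    snd @^-1` `[0, 1]%classic).
  apply/seteqP; split=> z /=; rewrite !in_itv /= => ?.
    by apply/fjord_closure_stretch.
  by apply/fjord_closure_stretch.
move/continuousP: stretch_continuous => _; apply: closed_comp.
  by move=> z _; apply: stretch_continuous.
apply: closedI; apply: closed_comp; try exact: interval_closed.
  by move=> z _; apply: cvg_fst.
by move=> z _; apply: cvg_snd.
Qed.

Lemma closure_fjord_domain : closure fjord_domain = fjord_closure.
Proof.
apply/seteqP; split=> [z cz|z].
  rewrite ((closure_id _).1 closed_fjord_closure).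
  apply: closureS cz => -[x y] [/= d1 d2].
  by split=> /=; apply/andP; split; apply: ltW; case/andP: d1; case/andP: d2.
rewrite fjord_closure_stretch => sz B.
rewrite -[z in nbhs z _]stretchK => /shrink_continuous /= nB.
set u := stretch z in sz nB.
(* Contraction towards the centre (1/2, 1/2): for 0 < e <= 1/2 it carries the closed square into the
   open one. *)
pose f (e : R) : R * R := ((1 - e) * u.1 + e / 2, (1 - e) * u.2 + e / 2).
have cf : f e @[e --> 0] --> u.
  have -> : u = f 0.
    by rewrite /f subr0 !mul1r !mul0r !addr0; case: (u).
  apply: cvg_mkpair => /=; apply: cvgD.
  - apply: cvgM; last exact: cvg_cst.
    by apply: cvgB; [exact: cvg_cst|exact: cvg_id].
  - by apply: cvgM; [exact: cvg_id|exact: cvg_cst].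
  - apply: cvgM; last exact: cvg_cst.
    by apply: cvgB; [exact: cvg_cst|exact: cvg_id].
  - by apply: cvgM; [exact: cvg_id|exact: cvg_cst].
have /nbhs_ballP[d /= d0 dP] := cf _ nB.
pose e := Num.min (d / 2) (1 / 2).
have e0 : 0 < e by rewrite lt_min; lra.
have [ed e1] : e <= d / 2 /\ e <= 1 / 2 by rewrite !ge_min !lexx orbT.
exists (shrink (f e)); split.
  apply/fjord_domain_stretch; rewrite shrinkK; case: sz => s1 s2.
  have mid (v : R) : 0 <= v <= 1 -> 0 < (1 - e) * v + e / 2 < 1.
    move=> /andP[v0 v1]; have e1' : 0 <= 1 - e by lra.
    have v1' : 0 <= 1 - v by lra.
    by have := mulr_ge0 e1' v0; have := mulr_ge0 e1' v1'; lra.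
  by split; apply: mid.
by apply: (dP e); rewrite /ball /= sub0r normrN gtr0_norm//; lra.
Qed.

Lemma boundary_fjord_domain :
  boundary fjord_domain = fjord_closure `\` fjord_domain.
Proof.
by rewrite /boundary closure_fjord_domain (interior_id _).1//;
  apply: open_fjord_domain.
Qed.

Lemma boundary_fjordP z : boundary fjord_domain z <->
  fjord_closure z /\ [\/ z.1 = 0, z.1 = 1, z.2 = 0 | z.2 = height z.1].
Proof.
rewrite boundary_fjord_domain; split=> [[[c1 c2] nd]|[[c1 c2] e]].
  split=> //; apply: contrapT => ne; apply: nd; split; apply/andP.
    split; rewrite lt_neqAle; [case/andP: c1 => -> _|case/andP: c1 => _ ->];
    by rewrite andbT; apply/eqP => e; apply: ne; rewrite e; constructor.
  split; rewrite lt_neqAle; [case/andP: c2 => -> _|case/andP: c2 => _ ->];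
  by rewrite andbT; apply/eqP => e; apply: ne; rewrite e; constructor.
split=> // -[d1 d2]; case: e => e; rewrite e in d1 d2; lra.
Qed.

End Fjords.
(** * Crosscuts and topology of the boundary *)

Section PlaneGeometry.
Variable R : realType.
Implicit Types (x y z w : R * R) (A B : set (R * R)).

Lemma dist_le x y : dist x y <= `|x.1 - y.1| + `|x.2 - y.2|.
Proof.
rewrite /dist -[leRHS]ger0_norm ?addr_ge0// -sqrtr_sqr ler_wsqrtr//.
rewrite -(real_normK (num_real (x.1 - y.1))) -(real_normK (num_real (x.2 - y.2))).
have := normr_ge0 (x.1 - y.1); have := normr_ge0 (x.2 - y.2).
by set a := `|_|; set b := `|_| => a0 b0; have := mulr_ge0 a0 b0; lra.
Qed.

Lemma dist_ge1 x y : `|x.1 - y.1| <= dist x y.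
Proof. by rewrite /dist -sqrtr_sqr ler_wsqrtr// lerDl sqr_ge0. Qed.

Lemma dist_ge2 x y : `|x.2 - y.2| <= dist x y.
Proof. by rewrite /dist -sqrtr_sqr ler_wsqrtr// lerDr sqr_ge0. Qed.

Lemma diam_ge A x y : A x -> A y -> ((dist x y)%:E <= diam A)%E.
Proof. by move=> Ax Ay; apply: ereal_sup_ubound; exists (x, y). Qed.

Lemma diam_le A (d : R) :
  (forall x y, A x -> A y -> dist x y <= d) -> (diam A <= d%:E)%E.
Proof.
move=> Ad; apply: ge_ereal_sup => _ [[x y] [/= Ax Ay] <-].
by rewrite lee_fin Ad.
Qed.

Lemma component_image A (f : R -> R * R) (a b : R) : continuous f -> a <= b ->
  (forall t, a <= t <= b -> A (f t)) -> connected_component A (f a) (f b).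
Proof.
move=> cf leab Af; exists (f @` `[a, b]); last first.
  by exists b => //=; rewrite in_itv /= leab lexx.
split; first by exists a => //=; rewrite in_itv /= leab lexx.
  by move=> q [t /=]; rewrite in_itv /= => tab <-; apply: Af.
apply: connected_continuous_connected; first exact: segment_connected.
exact: continuous_subspaceT.
Qed.

Lemma component_horizontal A (a b c : R) :
  (forall t, a <= t <= b \/ b <= t <= a -> A (t, c)) ->
  connected_component A (a, c) (b, c).
Proof.
have cf : continuous (fun t : R => (t, c)).
  by move=> t; apply: (@cvg_mkpair _ _ (nbhs t)); [exact: cvg_id|exact: cvg_cst].
move=> Ac; have [leab|/ltW leba] := leP a b.
  by apply: (component_image cf leab) => t ?; apply: Ac; left.
apply: connected_component_sym.
by apply: (component_image cf leba) => t ?; apply: Ac; right.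
Qed.

Lemma component_vertical A (a b c : R) :
  (forall t, a <= t <= b \/ b <= t <= a -> A (c, t)) ->
  connected_component A (c, a) (c, b).
Proof.
have cf : continuous (fun t : R => (c, t)).
  by move=> t; apply: (@cvg_mkpair _ _ (nbhs t)); [exact: cvg_cst|exact: cvg_id].
move=> Ac; have [leab|/ltW leba] := leP a b.
  by apply: (component_image cf leab) => t ?; apply: Ac; left.
apply: connected_component_sym.
by apply: (component_image cf leba) => t ?; apply: Ac; right.
Qed.

Lemma component_connected_set A w :
  (forall x, A x -> connected_component A w x) -> connected A.
Proof.
move=> Aw; suff <- : connected_component A w = A by exact: component_connected.
by apply/seteqP; split=> // x; apply: connected_component_sub.
Qed.

Lemma component_mono A B w :
  A `<=` B -> connected_component A w `<=` connected_component B w.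
Proof.
move=> AB x [C [Cw CA cC] Cx]; exists C => //.
by split=> //; apply: subset_trans AB.
Qed.

(** Intended for a crosscut and one of its endpoints, which lies only in the closure; approximating
    [p] by points of [A] loses nothing in the limit. *)
Lemma closure_in_box A p (r : R) : closure A p -> (diam A <= r%:E)%E ->
  forall z, A z -> `|z.1 - p.1| <= r /\ `|z.2 - p.2| <= r.
Proof.
move=> clp dA z Az.
have near (e : R) : 0 < e -> exists q, [/\ A q, `|p.1 - q.1| < e,
    `|p.2 - q.2| < e & dist z q <= r].
  move=> e0; have [q [Aq [/= q1 q2]]] := clp _ (nbhsx_ballx p e e0).
  by exists q; split=> //; rewrite -lee_fin; apply: le_trans dA; exact: diam_ge.
have tri (u v t : R) : `|u - t| <= `|v - t| + `|u - v|.
  by rewrite (_ : u - t = (v - t) + (u - v)) ?ler_normD//; ring.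
split; rewrite leNgt; apply/negP => lt.
  have e0 : 0 < `|z.1 - p.1| - r by lra.
  have [q [_ q1 _ dq]] := near _ e0; have := dist_ge1 z q.
  by have := tri z.1 q.1 p.1; rewrite (distrC q.1); lra.
have e0 : 0 < `|z.2 - p.2| - r by lra.
have [q [_ _ q2 dq]] := near _ e0; have := dist_ge2 z q.
by have := tri z.2 q.2 p.2; rewrite (distrC q.2); lra.
Qed.

End PlaneGeometry.

(** * Topology of the domain and of its boundary *)

Section FjordTopology.
Variables (R : realType) (T : nat -> nat -> bool).
Hypothesis T_functional : forall n t t', T n t -> T n t' -> t = t'.

Let W : set (R * R) := fjord_domain T.
Let h : R -> R := height T.
Let w : R * R := (1 / 2, 1 / 2).

(** No fjord reaches below 7/8, so each point moves vertically to the level 1/2 and then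
    horizontally to [w]. *)
Lemma fjord_domain_connected : connected W.
Proof.
apply: (@component_connected_set _ _ w) => -[x y] [/= x01 yh].
apply: connected_component_sym.
apply: (@connected_component_trans _ W (x, 1 / 2)).
  apply: component_vertical => t tb; split=> //=.
  by have := height_bounds T_functional x; case: tb => ?; lra.
apply: component_horizontal => t tb; split=> /=.
  by case: tb => ?; lra.
by have := height_bounds T_functional t; lra.
Qed.

(** The loop is stretched into the convex open square, contracted there along segments to its base
    point, and shrunk back. *)
Lemma fjord_domain_simply_connected : simply_connected W.
Proof.
split; first exact: fjord_domain_connected.
move=> f cf fW f01; set f' := fun t => stretch T (f t).
pose mix (p : R * R) (a b : R) : R := (1 - p.1) * a + p.1 * b.
pose H (p : R * R) : R * R := shrink T
  (mix p (f' p.2).1 (f' 0).1, mix p (f' p.2).2 (f' 0).2).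
have f'sq t : 0 <= t <= 1 -> open_square (f' t).
  move=> t01; apply/fjord_domain_stretch => //; apply: fW; apply: imageP.
  by rewrite /= in_itv.
exists H; split.
- apply/subspace_continuousP => -[s t] [_ /= t01].
  have cf't : f' q.2 @[q --> within (`[0, 1] `*` `[0, 1]) (nbhs (s, t))]
      --> f' t.
    apply: (cvg_comp (fun q : R * R => f q.2) (stretch T));
      last exact: stretch_continuous.
    have /subspace_continuousP/(_ t t01) ft := cf.
    have sndw : snd @ within (`[0, 1] `*` `[0, 1]) (nbhs (s, t)) `=>`
        within `[0, 1] (nbhs t).
      move=> B /= nB; have := @cvg_snd _ _ (nbhs s) (nbhs t) (nbhs_filter s) _ nB.
      move=> nB'; apply: (@filterS _ (nbhs (s, t)) _ _ _ _ nB') => q /= qB [_ ?].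
      exact: qB.
    exact: cvg_comp sndw ft.
  set F := within _ _ in cf't *.
  have c1 : q.1 @[q --> F] --> s.
    move=> B /= nB; have nB' := @cvg_fst _ _ (nbhs s) (nbhs t) (nbhs_filter t) _ nB.
    exact: (@filterS _ (nbhs (s, t)) _ _ _ _ nB').
  have cmix (f1 : R * R -> R) : {for f' t, continuous f1} ->
      mix q (f1 (f' q.2)) (f1 (f' 0)) @[q --> F] -->
      mix (s, t) (f1 (f' t)) (f1 (f' 0)).
    move=> cf1; apply: cvgD; apply: cvgM => //; last exact: cvg_cst.
      by apply: cvgB => //; exact: cvg_cst.
    exact: cvg_comp cf't cf1.
  apply: (cvg_comp (fun q : R * R => (mix q (f' q.2).1 (f' 0).1,
    mix q (f' q.2).2 (f' 0).2)) (shrink T)); last exact: shrink_continuous.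
  apply: cvg_mkpair.
    by apply: (cmix fst) => ?; apply: cvg_fst.
  by apply: (cmix snd) => ?; apply: cvg_snd.
- move=> _ [[s t] /= [s01 t01] <-]; rewrite !in_itv /= in s01 t01.
  apply/fjord_domain_stretch => //; rewrite shrinkK//.
  have [a1 a2] := f'sq _ t01; have o01 : 0 <= (0 : R) <= 1 by lra.
  have [b1 b2] := f'sq _ o01.
  have mid (a b : R) : 0 < a < 1 -> 0 < b < 1 ->
      0 < (1 - s) * a + s * b < 1.
    move=> ? ?; have [->|s0] := eqVneq s 0; first lra.
    have s0' : 0 < s by rewrite lt_neqAle eq_sym s0; case/andP: s01.
    apply/andP; split; nra.
  by split; apply: mid.
- move=> t t01; rewrite /H /mix /= subrr !mul0r !add0r subr0 !mul1r !addr0.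
  by split; exact: stretchK.
move=> s s01; rewrite /H /mix /f' -f01 /= -!mulrDl subrK !mul1r.
by split; exact: stretchK.
Qed.

Lemma fjord_domain_bounded : bounded_set W.
Proof.
exists 1; split; first exact: num_real.
move=> M M1 [x y] [/= x01 yh]; rewrite prod_normE /= ge_max.
have := height_bounds T_functional x.
by rewrite !ger0_norm; lra.
Qed.

Definition square_frame : set (R * R) :=
  [set z | closed_square z /\ [\/ z.1 = 0, z.1 = 1, z.2 = 0 | z.2 = 1]].

Lemma boundary_fjord_stretch z :
  boundary W z <-> square_frame (stretch T z).
Proof.
rewrite /W boundary_fjordP// /square_frame /= fjord_closure_stretch//.
have h0 := height_gt0 T_functional z.1.
split=> -[c e]; split=> //; case: e => /= e; rewrite ?e.
- exact: Or41.
- exact: Or42.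
- by apply: Or43; rewrite mul0r.
- by apply: Or44; rewrite divff// gt_eqF.
- exact: Or41.
- exact: Or42.
- by apply: Or43; move/eqP: e; rewrite mulf_eq0 invr_eq0 (gt_eqF h0) orbF => /eqP.
- by apply: Or44; rewrite -[LHS](divfK (x := height T z.1)) ?gt_eqF// e mul1r.
Qed.

(** The ball is a box with half-side at most 1/2, so it meets no side opposite to one containing
    [u]. A point of it is joined to [u] along a common side or through the corner between two
    adjacent ones, inside the box. *)
Lemma square_frame_ball_connected (u : R * R) (d : R) :
  square_frame u -> d <= 1 / 2 -> connected (square_frame `&` ball u d).
Proof.
move=> Fu d2; apply: (@component_connected_set _ _ u) => v [Fv [/= v1 v2]].
apply: connected_component_sym.
case: u v Fu Fv v1 v2 => [a b] [a' b'] [[/= a01 b01] uE] [[/= a01' b01'] vE].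
rewrite /ball /= !ltr_norml => v1 v2.
have d0 : 0 < d by lra.
have hor (s t c : R) : `|a - s| < d -> `|a - t| < d -> `|b - c| < d ->
    0 <= s <= 1 -> 0 <= t <= 1 -> c = 0 \/ c = 1 ->
    connected_component (square_frame `&` ball (a, b) d) (s, c) (t, c).
  rewrite !ltr_norml => sd td cd s01 t01 c01; apply: component_horizontal => x xb.
  split; last by split; rewrite /ball /= ltr_norml; case: xb => ?; lra.
  have x01 : 0 <= x <= 1 by case: xb => ?; lra.
  by case: c01 => ->; (split; first by split; rewrite /= ?lexx ?ler01);
    [apply: Or43|apply: Or44].
have ver (s t c : R) : `|b - s| < d -> `|b - t| < d -> `|a - c| < d ->
    0 <= s <= 1 -> 0 <= t <= 1 -> c = 0 \/ c = 1 ->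
    connected_component (square_frame `&` ball (a, b) d) (c, s) (c, t).
  rewrite !ltr_norml => sd td cd s01 t01 c01; apply: component_vertical => x xb.
  split; last by split; rewrite /ball /= ltr_norml; case: xb => ?; lra.
  have x01 : 0 <= x <= 1 by case: xb => ?; lra.
  by case: c01 => ->; (split; first by split; rewrite /= ?lexx ?ler01);
    [apply: Or41|apply: Or42].
have {}uE : (a = 0 \/ a = 1) \/ (b = 0 \/ b = 1) by case: uE; tauto.
have {}vE : (a' = 0 \/ a' = 1) \/ (b' = 0 \/ b' = 1) by case: vE; tauto.
case: uE => uE; case: vE => vE.
- have -> : a' = a by case: uE => ?; case: vE => ?; lra.
  by apply: ver; rewrite ?ltr_norml//; lra.
- apply: (@connected_component_trans _ (square_frame `&` ball (a, b) d) (a, b')).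
    by apply: hor; rewrite ?ltr_norml//; lra.
  by apply: ver; rewrite ?ltr_norml//; lra.
- apply: (@connected_component_trans _ (square_frame `&` ball (a, b) d) (a', b)).
    by apply: ver; rewrite ?ltr_norml//; lra.
  by apply: hor; rewrite ?ltr_norml//; lra.
have -> : b' = b by case: uE => ?; case: vE => ?; lra.
by apply: hor; rewrite ?ltr_norml//; lra.
Qed.

(** Local connectedness is transported from the frame of the square along the homeomorphism
    [stretch]. *)
Lemma boundary_fjord_locally_connected : locally_connected (boundary W).
Proof.
move=> x U bx oU Ux; set u := stretch T x.
have [d /= d0 dU] : nbhs_ball u (shrink T @^-1` U).
  apply/nbhs_ballP; apply: open_nbhs_nbhs; split.
    by apply: open_comp => // z _; exact: shrink_continuous.
  by rewrite /= stretchK.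
pose e := Num.min d (1 / 2).
have [e0 ed e2] : [/\ 0 < e, e <= d & e <= 1 / 2].
  by rewrite lt_min !ge_min !lexx orbT; split=> //; lra.
have Vi : boundary W `&` stretch T @^-1` ball u e
    = shrink T @` (square_frame `&` ball u e).
  apply/seteqP; split=> [z [/boundary_fjord_stretch Fz bz]|_ [z [Fz bz] <-]].
    by exists (stretch T z); rewrite ?stretchK.
  by split; [apply/boundary_fjord_stretch|]; rewrite /= shrinkK.
exists (stretch T @^-1` ball u e); split.
- by apply: open_comp; [move=> z _; exact: stretch_continuous|exact: ball_open].
- exact: ballxx.
- move=> z [_ /= bz]; rewrite -(stretchK T_functional z); apply: dU.
  exact: le_ball bz.
rewrite Vi; apply: connected_continuous_connected.
  by apply: square_frame_ball_connected => //; apply/boundary_fjord_stretch.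
by apply: continuous_subspaceT; exact: shrink_continuous.
Qed.

(** Neighbouring tents end below 9/16 and start above 7/4 of [tip n], outside this window. *)
Lemma depth_near_tip n (s : R) : `|s - tip R n| <= tip R n / 4 ->
  depth T s = 0 \/ exists2 t, T n t & depth T s = bump n t s.
Proof.
move=> sn; case: (depth_cases T_functional s) => [[-> _]|[n' [t [Tt b0 ->]]]].
  by left.
suff en : n' = n by right; exists t; rewrite -en.
have := bump_gt0 b0; move: sn; rewrite ltr_norml ler_norml => sn sn'.
have := tip_gt0 R n; have := tip_gt0 R n'.
by case: (ltngtP n n') => // /(tip_lt R) ? ? ?; exfalso; lra.
Qed.

Lemma depth_away n (s x : R) : `|s - tip R n| <= tip R n / 4 ->
  `|x - tip R n| <= `|s - tip R n| -> depth T s <= depth T x.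
Proof.
move=> sn xs; case: (depth_near_tip sn) => [->|[t Tt ->]]; first exact: depth_ge0.
apply: le_trans (depth_ge T_functional x Tt).
rewrite /bump ge_max !le_max lexx /=; apply/orP; right.
have e0 : 0 <= 2 ^+ t.+1 :> R by rewrite exprn_ge0.
by have := ler_wpM2l e0 xs; lra.
Qed.

(** * Paths to the base point around a box centred at a boundary point *)

Section Escape.
Variables (p : R * R) (r : R).
Hypothesis bp : boundary W p.

Let A : set (R * R) :=
  W `\` [set z | `|z.1 - p.1| <= r /\ `|z.2 - p.2| <= r].

Let far (a b : R) := a < b - r \/ b + r < a.

Let AP (a b : R) : 0 < a < 1 -> 0 < b < h a -> far a p.1 \/ far b p.2 -> A (a, b).
Proof.
move=> a01 bh f; split=> //= -[]; rewrite !ler_norml.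
by rewrite /far in f; move=> ? ?; case: f => -[] ?; lra.
Qed.

Let p_cases : [\/ p.1 = 0, p.1 = 1, p.2 = 0 | p.2 = h p.1].
Proof. by have /boundary_fjordP[] := bp. Qed.

Let h_bounds (a : R) : 7 / 8 <= h a <= 1.
Proof. exact: height_bounds. Qed.

(** The path runs at level [b] to the abscissa 1/2 and then vertically to [w]. The vertical part
    avoids the box: [p] is on a lateral side, or at the bottom with [b] already above the box, or at
    height at least 7/8. *)
Lemma escape_low (a b : R) : 0 < r -> r < 1 / 32 ->
  0 < a < 1 -> 0 < b -> b <= 3 / 4 -> far b p.2 ->
  connected_component A (a, b) w.
Proof.
move=> r0 r1 a01 b0 b34 f; apply: (@connected_component_trans _ A (1 / 2, b)).
  apply: component_horizontal => t tb; have := h_bounds t => ht.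
  by apply: AP; [case: tb => ?; lra|lra|right].
apply: component_vertical => t tb; have h2 := h_bounds (1 / 2).
have hp := h_bounds p.1; apply: AP; first lra.
  by case: tb => ?; lra.
rewrite /far in f *; case: p_cases => e.
- by left; right; lra.
- by left; left; lra.
- by right; right; case: tb; case: f => ? ?; lra.
- by right; left; case: tb; case: f => ? ?; lra.
Qed.

Lemma escape_side (a b : R) : 0 < r -> r < 1 / 32 -> W (a, b) -> far a p.1 ->
  connected_component A (a, b) w.
Proof.
move=> r0 r1 [/= a01 bh] f; have ha := h_bounds a.
(* One of the levels 1/3 and 2/3 lies across 1/2 from [p.2], hence clear of the box. *)
have [l [l0 l34 fl]] : exists l, [/\ 1 / 4 <= l, l <= 3 / 4 & far l p.2].
  rewrite /far; have [?|?] := ltP p.2 (1 / 2).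
    by exists (2 / 3); split; first [lra|right; lra].
  by exists (1 / 3); split; first [lra|left; lra].
apply: (@connected_component_trans _ A (a, l)).
  apply: component_vertical => t tb; apply: AP => //; last by left.
  by rewrite -/h in bh; case: tb => ?; lra.
by apply: escape_low => //; lra.
Qed.

Lemma escape (z : R * R) : 0 < r -> r < 1 / 32 -> W z ->
  4 * r < `|z.1 - p.1| \/ 4 * r < `|z.2 - p.2| -> connected_component A z w.
Proof.
case: z => a b r0 r1 Wz /=; have [/= a01 bh] := Wz; rewrite -/h in bh => far4.
have ha := h_bounds a; have hp := h_bounds p.1.
have [f|nf] := pselect (far a p.1); first exact: escape_side.
have na : p.1 - r <= a <= p.1 + r.
  by apply/andP; split; rewrite leNgt; apply/negP => ?; apply: nf;
    [left|right].
have {far4} fb : b < p.2 - 4 * r \/ p.2 + 4 * r < b.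
  case: far4; rewrite ltr_normr => /orP[] ?; try by exfalso; lra.
    by right; lra.
  by left; lra.
have down (l : R) : 0 < l -> l <= b -> (b < p.2 - r \/ p.2 + r < l) ->
    connected_component A (a, b) (a, l).
  move=> l0 lb f; apply: component_vertical => t tb; apply: AP => //.
    by case: tb => ?; lra.
  by right; rewrite /far; case: tb => ?; case: f => ?; [left|right|left|right]; lra.
have [b34|b34] := leP b (3 / 4).
  by apply: escape_low => //; [lra|case: fb => ?; [left|right]; lra].
(* If [z] is below the box, or the box is low, a descent to 3/4 suffices. What remains is [z] above
   a high box, where the path must go sideways between the box and the fjords. *)
have [lp|gp] := ltP b p.2.
  apply: (@connected_component_trans _ A (a, 3 / 4)).
    by apply: down; first [lra|left; lra].
  by apply: escape_low => //; first [lra|left; lra].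
have [p34|p34] := ltP p.2 (3 / 4 - r).
  apply: (@connected_component_trans _ A (a, 3 / 4)).
    by apply: down; first [lra|right; lra].
  by apply: escape_low => //; first [lra|right; lra].
case: p_cases => e; rewrite ?e in na *.
(* Left edge: here [p.2 + 4 * r < 1], so at level [p.2 + 2 * r] [depth_le_id] keeps the way free up
   to abscissa [2 * r]. *)
- apply: (@connected_component_trans _ A (a, p.2 + 2 * r)).
    by apply: down; first [lra|right; lra].
  have Wt (t : R) : 0 < t -> t <= 2 * r -> 0 < p.2 + 2 * r < h t.
    move=> t0 t2; have := depth_le_id T_functional (ltW t0).
    by rewrite /h /height; lra.
  apply: (@connected_component_trans _ A (2 * r, p.2 + 2 * r)).
    apply: component_horizontal => t tb; apply: AP; last by right; right; lra.
      by case: tb => ?; lra.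
    by apply: Wt; case: tb => ?; lra.
  by apply: escape_side => //;
    [split; [rewrite /=; lra|apply: (Wt (2 * r)); lra]|right; lra].
- have Wt (t : R) : 3 / 4 <= t -> 0 < b < h t.
    by move=> t34; rewrite /h /height (depth_near_one T_functional t34); lra.
  apply: (@connected_component_trans _ A (1 - 2 * r, b)).
    apply: component_horizontal => t tb; apply: AP; last by right; right; lra.
      by case: tb => ?; lra.
    by apply: Wt; case: tb => ?; lra.
  by apply: escape_side => //;
    [split; [rewrite /=; lra|apply: (Wt (1 - 2 * r)); lra]|left; lra].
- by exfalso; lra.
(* Upper side: a point lies more than [4 * r] above [p], so [p] is on the wall of a fjord deeper
   than that, whose tip exceeds [16 * r]. *)
have dp : 4 * r < depth T p.1 by move: e; rewrite /h /height; lra.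
case: (depth_cases T_functional p.1) => [[d0 _]|[n [t [Tt b0 dE]]]]; first lra.
have tn := tip_gt0 R n; have tn2 := tip_le_half R n.
have rt : 16 * r < tip R n by have := bump_le n t p.1; lra.
have := bump_gt0 b0; rewrite ltr_norml => np.
have pb : p.2 + 4 * r < b by lra.
have {bh} Wt (s : R) : `|s - tip R n| <= tip R n / 4 ->
    `|a - tip R n| <= `|s - tip R n| -> 0 < b < h s.
  move=> sn sa; have := depth_away sn sa; move: bh; rewrite /h /height; lra.
clear Wz nf ha hp fb down b34 gp p34 e dp dE b0 Tt t.
(* Moving away from the axis of the fjord on the side of [a] only gains room. The target, a quarter
   of the tip from the axis, is over an eighth of the tip from [p.1], which exceeds [2 * r]. *)
have [ta|at_] := leP (tip R n) a.
  have {}Wt s : a <= s -> s <= 5 / 4 * tip R n -> 0 < b < h s.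
    by move=> *; apply: Wt; rewrite !ger0_norm; lra.
  apply: (@connected_component_trans _ A (5 / 4 * tip R n, b)).
    apply: component_horizontal => s sb; apply: AP; last by right; right; lra.
      by case: sb => ?; lra.
    by apply: Wt; case: sb => ?; lra.
  apply: escape_side => //; last by right; lra.
  by split; [rewrite /=; lra|apply: (Wt (5 / 4 * tip R n)); lra].
have {}Wt s : s <= a -> 3 / 4 * tip R n <= s -> 0 < b < h s.
  by move=> *; apply: Wt; rewrite !ler0_norm; lra.
apply: (@connected_component_trans _ A (3 / 4 * tip R n, b)).
  apply: component_horizontal => s sb; apply: AP; last by right; right; lra.
    by case: sb => ?; lra.
  by apply: Wt; case: sb => ?; lra.
apply: escape_side => //; last by left; lra.
by split; [rewrite /=; lra|apply: (Wt (3 / 4 * tip R n)); lra].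
Qed.

End Escape.

(** A point of [N] outside the box of half-side [4 * r] would be connected to [w] off [gamma] by
    [escape], putting [w] into [N]. *)
Lemma fjord_caratheodory_modulus :
  caratheodory_modulus W w (1 / 32) (fun r => 32 * r).
Proof.
split=> [r s r0 rs _|gamma N]; first by lra.
move=> [gW _ [f [[_ [fim _ _] _] bf _]]] ngw [[x Wx NE] nNw] r dr r1.
set p := f 0 in bf.
have clp : closure gamma p by apply: fim => /=; rewrite in_itv /= lexx ler01.
have r0 : 0 < r.
  have [q [gq _]] := clp _ (nbhsx_ballx p 1 ltr01).
  rewrite -lte_fin; apply: le_lt_trans dr; apply: le_trans (diam_ge gq gq).
  by rewrite lee_fin sqrtr_ge0.
have gQ := closure_in_box clp (ltW dr).
have NQ z : N z -> `|z.1 - p.1| <= 4 * r /\ `|z.2 - p.2| <= 4 * r.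
  move=> Nz; have Nxz := Nz; rewrite NE in Nxz.
  have [Wz _] := connected_component_sub Nxz.
  suff nfar : ~ (4 * r < `|z.1 - p.1| \/ 4 * r < `|z.2 - p.2|).
    by split; rewrite leNgt; apply/negP => ?; apply: nfar; [left|right].
  move=> /(escape bf r0 r1 Wz) zw; apply: nNw; rewrite NE.
  apply: connected_component_trans Nxz _; apply: component_mono zw => q [Wq nQ].
  by split=> // /gQ.
(* Each coordinate varies by at most [8 * r] over [N]; their sum bounds the distance. *)
apply: (@le_lt_trans _ _ (16 * r)%:E); last by rewrite lte_fin; lra.
apply: diam_le => z z' /NQ[z1 z2] /NQ[z1' z2'].
apply: le_trans (dist_le _ _) _.
have tri (u v t : R) : `|u - t| <= `|u - v| + `|t - v|.
  by have := ler_normB (u - v) (t - v); rewrite opprB addrA subrK.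
by have := tri z.1 p.1 z'.1; have := tri z.2 p.2 z'.2; lra.
Qed.

End FjordTopology.
(** * Computability *)

Lemma ratr_rat_of_code (R : realType) n :
  ratr (rat_of_code n) = ((unpair (unpair n).1).1%:R - (unpair (unpair n).1).2%:R)
    / (unpair n).2.+1%:R :> R.
Proof.
rewrite /rat_of_code; case: (unpair n) => c q /=; case: (unpair c) => p p' /=.
by rewrite fmorph_div rmorphB; congr ((_ - _) / _); exact: ratr_nat.
Qed.

Lemma ratr_posrat_of_code (R : realType) n :
  ratr (posrat_of_code n) = (unpair n).1.+1%:R / (unpair n).2.+1%:R :> R.
Proof.
rewrite /posrat_of_code; case: (unpair n) => p q /=.
by rewrite fmorph_div; congr (_ / _); exact: ratr_nat.
Qed.

(** Since 32 = 2^5, the oracle is queried at precision [n + 5]; both parts of the signed numerator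
    are multiplied by 32. *)
Lemma computable_on_scale32 (R : realType) (a : R) :
  computable_on a (fun r => 32 * r).
Proof.
have [c32 c32P] : recursive (fun v => cpair (cpair
    (32 * (unpair (unpair v).1).1) (32 * (unpair (unpair v).1).2)) (unpair v).2).
  by prove_recursive.
have [c5 c5P] : recursive (fun n => n + 5)%N by prove_recursive.
exists (Comp c32 (Comp Oracle c5)) => x phi x0 xa xphi n.
eexists.
  apply: eval_Comp (c32P _ _); apply: eval_Comp (c5P _ _) _.
  exact: eval_Oracle.
have := xphi (n + 5)%N; rewrite !ratr_rat_of_code !cpairK /= !natrM.
set p := _%:R; set p' := _%:R; set q := _%:R => lt.
have -> : (32%:R * p - 32%:R * p') / q - 32 * x = 32 * ((p - p') / q - x).
  by rewrite -mulrBr -mulrA -mulrBr.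
rewrite normrM ger0_norm//; apply: lt_le_trans (_ : 32 * 2 ^- (n + 5) <= _).
  by rewrite ltr_pM2l.
have -> : 32 = 2 ^+ 5 :> R by rewrite -natrX.
by rewrite exprD invfM mulrCA divff ?mulr1// gt_eqF// exprn_gt0.
Qed.

Lemma natr_subn_max (R : realType) (a b : nat) :
  (a - b)%:R = Num.max 0 (a%:R - b%:R) :> R.
Proof.
have [leba|ltab] := leqP b a.
  by rewrite natrB// max_r// subr_ge0 ler_nat.
have leab := ltnW ltab; rewrite (eqP (_ : a - b == 0)%N)// max_l//.
by rewrite subr_le0 ler_nat.
Qed.

Lemma natr_distn (R : realType) (a b : nat) :
  ((a - b) + (b - a))%:R = `|a%:R - b%:R| :> R.
Proof.
wlog leab : a b / (a <= b)%N => [wl|].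
  by have [/wl//|/ltnW/wl] := leqP a b; rewrite addnC distrC.
rewrite distrC ger0_norm ?subr_ge0 ?ler_nat//.
by rewrite (eqP (_ : a - b == 0)%N)// add0n natrB.
Qed.

Lemma double_half_width (R : realType) n t :
  2 * (tip R n / 4 / 2 ^+ t.+1) = 2 ^- (n + t + 3).
Proof.
have -> : 4 = 2 ^+ 2 :> R by rewrite -natrX.
rewrite /tip -!invfM -!exprD (_ : n.+1 + 2 + t.+1 = (n + t + 3).+1)%N;
  last by rewrite !addSn addnAC !addnS.
by rewrite exprS invfM mulrA divff ?mul1r// pnatr_eq0.
Qed.

(* [2 ^ M] times the bump at the dyadic point [i / 2 ^ M]. *)
Definition grid_bump (M n t i : nat) : nat :=
  (2 ^ (M - (n + 3)) -
   2 ^ t.+1 * ((i - 2 ^ (M - n.+1)) + (2 ^ (M - n.+1) - i)))%N.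

(** The bound on [n] makes the subtractions in the exponents exact, and the outer truncated
    subtraction is the [max 0] of [bump]; thus nothing is rounded. *)
Lemma grid_bumpE (R : realType) (M n t i : nat) : (n + 3 <= M)%N ->
  (grid_bump M n t i)%:R / 2 ^+ M = bump n t (i%:R / 2 ^+ M) :> R.
Proof.
move=> leM; have M0 : 0 < 2 ^+ M :> R by rewrite exprn_gt0.
have pow k : (k <= M)%N -> (2 ^ (M - k))%:R = 2 ^+ M / 2 ^+ k :> R.
  by move=> lek; rewrite natrX expfB_cond// pnatr_eq0.
have leM' : (n.+1 <= M)%N by apply: leq_trans leM; rewrite addnS ltnS leq_addr.
rewrite /grid_bump natr_subn_max natrM natr_distn !pow// natrX.
rewrite /bump maxr_pMl ?invr_ge0 ?ltW// mul0r; congr (Num.max _ _).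
rewrite mulrBl; congr (_ - _).
  rewrite mulrAC divff ?gt_eqF// mul1r /tip -invfM; congr (_^-1).
  by rewrite addn3 !exprS; ring.
rewrite -mulrA; congr (_ * _).
rewrite -[X in _ * X](gtr0_norm (x := (2 ^+ M)^-1)) ?invr_gt0// -normrM mulrBl.
by rewrite [_ / _ / _]mulrAC divff ?gt_eqF// mul1r.
Qed.

(** * Approximation of the closure on a dyadic grid, and what a computable modulus of local
    connectivity decides *)

Section Computability.
Variables (R : realType) (f : nat -> nat).
Hypothesis f_functional : forall n t t',
  f (cpair n t) = 0%N -> f (cpair n t') = 0%N -> t = t'.
Hypothesis f_recursive : recursive f.

Let T (n t : nat) : bool := f (cpair n t) == 0%N.

Let T_functional n t t' : T n t -> T n t' -> t = t'.
Proof. by move=> /eqP + /eqP; exact: f_functional. Qed.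

Let K : set (R * R) := fjord_closure T.

Lemma fjord_closure_compact : compact K.
Proof.
have -> : K = shrink T @` (`[0, 1] `*` `[0, 1]).
  apply/seteqP; split=> [z /(fjord_closure_stretch T_functional)[z1 z2]|].
    exists (stretch T z); last exact: stretchK.
    by split; rewrite /= in_itv.
  move=> _ [z [z1 z2] <-]; apply/fjord_closure_stretch => //.
  by rewrite shrinkK//; move: z1 z2; rewrite /= !in_itv.
apply: continuous_compact; last by apply: compact_setX; exact: segment_compact.
by apply: continuous_subspaceT; exact: shrink_continuous.
Qed.

Definition grid_point (M i j : nat) : R * R := (i%:R / 2 ^+ M, j%:R / 2 ^+ M).

(** A finite test, consulting only fjords of index and stage below [N]. Any other fjord has width
    2^-(n+t+3), less than 2^-N. *)
Definition grid_fits (N M i j : nat) : Prop :=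
  [/\ (i <= 2 ^ M)%N, (j <= 2 ^ M)%N & forall n t, (n < N)%N -> (t < N)%N ->
      T n t -> (j + grid_bump M n t i <= 2 ^ M)%N].

Lemma pow2_le (M N : nat) : (N <= M)%N -> 2 ^- M <= 2 ^- N :> R.
Proof. by move=> le; rewrite lef_pV2 ?posrE ?exprn_gt0// ler_eXn2l ?ltr1n. Qed.

(** A point that passes the test but lies over an unconsulted fjord is moved horizontally to the
    left rim [tip n - e], where the depth is 0. *)
Lemma grid_fits_near (N M i j : nat) : (N + 3 <= M)%N -> grid_fits N M i j ->
  exists z, [/\ K z, `|z.1 - (grid_point M i j).1| <= 2 ^- N &
                z.2 = (grid_point M i j).2].
Proof.
move=> leM [iM jM fits]; have M0 : 0 < 2 ^+ M :> R by rewrite exprn_gt0.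
rewrite /grid_point /=; set x := i%:R / _; set y := j%:R / _.
have x01 : 0 <= x <= 1.
  by rewrite divr_ge0 ?(ltW M0)//= ler_pdivrMr// mul1r -natrX ler_nat.
have y01 : 0 <= y <= 1.
  by rewrite divr_ge0 ?(ltW M0)//= ler_pdivrMr// mul1r -natrX ler_nat.
have inK : y + depth T x <= 1 ->
    exists z, [/\ K z, `|z.1 - x| <= 2 ^- N & z.2 = y].
  move=> yx; exists (x, y); split=> //=; last first.
    by rewrite subrr normr0 invr_ge0 exprn_ge0.
  by split=> //=; rewrite /height; lra.
case: (depth_cases T_functional x) => [[d0 _]|[n [t [Tnt b0 dE]]]].
  by apply: inK; lra.
have [/andP[ltn ltt]|] := boolP ((n < N) && (t < N))%N.
  apply: inK; rewrite dE -grid_bumpE;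
  last by apply: leq_trans leM; rewrite leq_add2r ltnW.
  rewrite -mulrDl ler_pdivrMr// mul1r -natrD -natrX ler_nat.
  exact: fits.
rewrite negb_and -!leqNgt => big.
have E0 : 0 < 2 ^+ t.+1 :> R by rewrite exprn_gt0.
have tn := tip_gt0 R n; have tn2 := tip_le_half R n.
pose e := tip R n / 4 / 2 ^+ t.+1.
have eE : e * 2 ^+ t.+1 = tip R n / 4 by rewrite divfK// gt_eqF.
have e0 : 0 < e by rewrite !divr_gt0.
have e2 := exp2_ge2 R t.
have e8 : e <= tip R n / 8 by nra.
have xe : `|x - tip R n| < e.
  rewrite ltr_pdivlMr// mulrC; move: b0.
  by rewrite lt_max ltxx /= subr_gt0.
exists (tip R n - e, y); split=> //=.
  split=> /=; first lra.
  suff d0 : depth T (tip R n - e) = 0 by rewrite /height d0; lra.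
  have /(depth_near_tip T_functional)[//|[t' Tnt' ->]] :
      `|tip R n - e - tip R n| <= tip R n / 4.
    by rewrite ler_norml; lra.
  rewrite (T_functional Tnt' Tnt) /bump addrAC subrr add0r normrN gtr0_norm//.
  by rewrite [2 ^+ _ * _]mulrC eE subrr maxxx.
have e2N : 2 * e <= 2 ^- N.
  rewrite double_half_width.
  apply: pow2_le; apply: leq_trans (leq_addr _ _).
  by case/orP: big => /leq_trans; apply; rewrite ?leq_addr ?leq_addl.
by rewrite ler_norml; move: xe; rewrite ltr_norml; lra.
Qed.

(** Rounding the abscissa by at most 2^-M can deepen a consulted fjord, of slope at most 2^N, by 2^N
    / 2^M. The ordinate is therefore lowered by 2^N further grid steps. *)
Lemma near_grid_fits (N M : nat) (z : R * R) : (N + 3 <= M)%N -> K z ->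
  exists i j, [/\ grid_fits N M i j, `|z.1 - (grid_point M i j).1| <= 2 ^- M &
    `|z.2 - (grid_point M i j).2| <= (2 ^+ N + 1) / 2 ^+ M].
Proof.
move=> leM; case: z => x y [/= x01 y01].
have M0 : 0 < 2 ^+ M :> R by rewrite exprn_gt0.
have N0 : 0 < 2 ^+ N :> R by rewrite exprn_gt0.
have hb := height_bounds T_functional x.
have floorP (u : R) : 0 <= u -> exists k : nat,
    k%:R / 2 ^+ M <= u /\ u < k.+1%:R / 2 ^+ M.
  move=> u0; have uM : 0 <= u * 2 ^+ M by rewrite mulr_ge0 ?(ltW M0).
  exists (Num.truncn (u * 2 ^+ M)); have := truncn_itv uM.
  by rewrite ler_pdivrMr// ltr_pdivlMr// => /andP.
have [/andP[x0 x1] /andP[y0 y1]] := (x01, y01).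
have [i [ix xi]] := floorP _ x0; have [k [ky yk]] := floorP _ y0.
have le1 l (u : R) : l%:R / 2 ^+ M <= u -> u <= 1 -> (l <= 2 ^ M)%N.
  move=> lu u1; have := le_trans lu u1.
  by rewrite ler_pdivrMr// mul1r -natrX ler_nat.
have S l : l.+1%:R / 2 ^+ M = l%:R / 2 ^+ M + 2 ^- M :> R.
  by rewrite -natr1 mulrDl mul1r.
rewrite !S in xi yk.
have NM : (2 ^+ N + 1) / 2 ^+ M = 2 ^+ N / 2 ^+ M + 2 ^- M :> R.
  by rewrite mulrDl mul1r.
have NM0 : 0 < 2 ^+ N / 2 ^+ M :> R by rewrite divr_gt0.
have kN : k%:R / 2 ^+ M - 2 ^+ N / 2 ^+ M <= (k - 2 ^ N)%:R / 2 ^+ M :> R.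
  rewrite -mulrBl ler_pM2r ?invr_gt0// natr_subn_max natrX.
  by rewrite le_max lexx orbT.
have kN' : (k - 2 ^ N)%:R / 2 ^+ M <= k%:R / 2 ^+ M :> R.
  by rewrite ler_pM2r ?invr_gt0// ler_nat leq_subr.
exists i, (k - 2 ^ N)%N; split=> /=; last first.
- by rewrite NM ler_norml; lra.
- by rewrite ler_norml; lra.
split; [exact: le1 ix x1|by apply: (le1 _ y); lra|move=> n t ltn ltt Tnt].
have bnd : bump n t (i%:R / 2 ^+ M) <= depth T x + 2 ^+ N / 2 ^+ M.
  apply: le_trans (bump_lipschitz _ _ _ x) _.
  apply: lerD; first exact: depth_ge.
  apply: ler_pM; rewrite ?exprn_ge0 ?normr_ge0 ?ler_eXn2l ?ltr1n//.
  by rewrite ler_norml; lra.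
rewrite -(ler_nat R) natrD natrX -[leRHS]mul1r -ler_pdivrMr// mulrDl.
rewrite grid_bumpE;
  last by apply: leq_trans leM; rewrite leq_add2r ltnW.
(* When the lowering is truncated at ordinate 0, the point fits because tents have height at most
   1/8. *)
have [lekN|ltNk] := leqP k (2 ^ N).
  rewrite (eqP (_ : k - 2 ^ N == 0)%N)// mul0r.
  by have := bump_le n t (i%:R / 2 ^+ M : R); have := tip_le_half R n; lra.
rewrite (natrB _ (ltnW ltNk)) natrX mulrBl.
by move: y01; rewrite /height; lra.
Qed.

(** Each truncated difference vanishes exactly when its inequality holds; the factor
    [1 - f (cpair n t)] switches off absent fjords. *)
Definition misfit (N M i j : nat) : nat :=
  ((i - 2 ^ M) + (j - 2 ^ M) + \sum_(n < N) \sum_(t < N)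
    (1 - f (cpair n t)) * ((j + grid_bump M n t i) - 2 ^ M))%N.

Lemma misfitP N M i j : misfit N M i j = 0%N <-> grid_fits N M i j.
Proof.
split=> [/eqP|[iM jM fits]].
  rewrite /misfit !addn_eq0 !subn_eq0 => /andP[/andP[iM jM]].
  rewrite sum_nat_eq0 => /forallP fits; split=> // n t ltn ltt /eqP Tnt.
  have := fits (Ordinal ltn); rewrite sum_nat_eq0 => /forallP /(_ (Ordinal ltt)).
  by rewrite /= Tnt subn0 mul1n subn_eq0.
rewrite /misfit big1 => [|n _].
  by apply/eqP; rewrite !addn_eq0 !subn_eq0 iM jM.
rewrite big1 => // t _; apply/eqP; rewrite muln_eq0 !subn_eq0.
have [Tnt|] := boolP (T n t); first by rewrite fits ?orbT.
by rewrite /T -lt0n => ->.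
Qed.

(** Denominators and the numerator of the radius are stored minus one, whence [2 ^ M - 1] and the 0
    before the last of these. *)
Definition disk_number (M i j : nat) : nat :=
  cpair (cpair (cpair (cpair i 0) (2 ^ M - 1)) (cpair (cpair j 0) (2 ^ M - 1)))
        (cpair 0 (2 ^ M - 1)).

Lemma disk_numberE M i j :
  disk_of_code (disk_number M i j) = closed_disk (grid_point M i j) (2 ^- M).
Proof.
rewrite /disk_of_code /disk_number !cpairK ratr_posrat_of_code !ratr_rat_of_code.
by rewrite !cpairK /= subr0 subr0 subn1 prednK ?expn_gt0// natrX div1r.
Qed.

(* The points failing the test are replaced by the origin, which passes it. *)
Definition grid_disk (N M k : nat) : nat :=
  let b := (1 - misfit N M (unpair k).1 (unpair k).2)%N in
  disk_number M (b * (unpair k).1) (b * (unpair k).2).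

(** Putting [d] in front of a list with code [a] gives the code [2 ^ d * (a + a).+1] of [CodeSeq].
    As [cpair] is monotone, the bound covers every grid point of the square. *)
Definition disk_list (N M : nat) : nat :=
  nat_rec (fun=> nat) 0%N (fun k a => 2 ^ grid_disk N M k * (a + a).+1)%N
    (cpair (2 ^ M) (2 ^ M)).+1.

Lemma grid_fits00 N M : (N + 3 <= M)%N -> grid_fits N M 0 0.
Proof.
move=> leM; split=> // n t ltn _ _; rewrite add0n -(ler_nat R) natrX.
rewrite -[leRHS]mul1r -ler_pdivrMr ?exprn_gt0// grid_bumpE;
  last by apply: leq_trans leM; rewrite leq_add2r ltnW.
by have := bump_le n t (0%:R / 2 ^+ M : R); have := tip_le_half R n; lra.
Qed.

Lemma cpair_le i j i' j' : (i <= i')%N -> (j <= j')%N ->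
  (cpair i j <= cpair i' j')%N.
Proof. by move=> ii jj; rewrite leq_add// leq_bin2l// ltnS leq_add. Qed.

Lemma mem_disk_list N M d : (N + 3 <= M)%N ->
  d \in CodeSeq.decode (disk_list N M) <->
  exists i j, grid_fits N M i j /\ d = disk_number M i j.
Proof.
move=> leM.
have -> : disk_list N M = CodeSeq.code
    [seq grid_disk N M k | k <- rev (iota 0 (cpair (2 ^ M) (2 ^ M)).+1)].
  rewrite /disk_list; elim: (cpair _ _).+1 => // k IHk.
  rewrite (_ : iota 0 k.+1 = rcons (iota 0 k) k); last first.
    by rewrite -addn1 iotaD cats1.
  by rewrite rev_rcons /= IHk addnn.
rewrite CodeSeq.codeK; split=> [/mapP[k _ ->]|[i [j [fits ->]]]].
  set i := (unpair k).1; set j := (unpair k).2.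
  rewrite /grid_disk -/i -/j; case e : (misfit N M i j) => [|m].
    by exists i, j; split; [apply/misfitP|rewrite subn0 !mul1n].
  by exists 0%N, 0%N; split; [exact: grid_fits00|rewrite subSS sub0n !mul0n].
apply/mapP; exists (cpair i j).
  by rewrite mem_rev mem_iota add0n ltnS; case: fits => iM jM _; rewrite cpair_le.
by rewrite /grid_disk cpairK /=; move/misfitP: fits => ->; rewrite subn0 !mul1n.
Qed.

Lemma recursive_disk_list (N M : nat -> nat) :
  recursive N -> recursive M -> recursive (fun n => disk_list (N n) (M n)).
Proof.
move=> rN rM; have rfst g : recursive g -> recursive (fun m => g (unpair m).1).
  by move=> rg; apply: recursive_comp rg _; prove_recursive.
apply: (recursive_rec
  (G := fun n k a => 2 ^ grid_disk (N n) (M n) k * (a + a).+1)%N);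
  [|prove_recursive|]; last first.
  by prove_recursive.
apply: recursive_mul; last by prove_recursive.
apply: recursive_exp2; rewrite /grid_disk /disk_number.
have rmisfit (N' M' i j : nat -> nat) : recursive N' -> recursive M' ->
    recursive i -> recursive j ->
    recursive (fun m => misfit (N' m) (M' m) (i m) (j m)).
  move=> rN' rM' ri rj; apply: recursive_add; first by prove_recursive.
  pose term m n t :=
    ((1 - f (cpair n t)) * ((j m + grid_bump (M' m) n t (i m)) - 2 ^ M' m))%N.
  apply: (recursive_sum (F := fun m n => \sum_(t < N' m) term m n t)%N) => //.
  apply: (recursive_sum (F := fun m => term (unpair m).1 (unpair m).2));
    last by apply: (rfst).
  have lift2 g : recursive g -> recursive (fun m => g (unpair (unpair m).1).1).
    by move=> rg; exact: rfst (rfst _ rg).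
  apply: recursive_mul.
    apply: recursive_sub; first by prove_recursive.
    by apply: recursive_comp f_recursive _; prove_recursive.
  rewrite /grid_bump; apply: recursive_sub.
    apply: recursive_add; first exact: lift2.
    by prove_recursive; exact: lift2.
  by prove_recursive; exact: lift2.
have rM' := rfst _ rM; have rN' := rfst _ rN.
by repeat first [apply: (rmisfit) | assumption | recursive_step].
Qed.

Lemma fjord_closure_computable : computable_compact K.
Proof.
split; first exact: fjord_closure_compact.
have [c cP] : recursive (fun n => disk_list (n + 3) (2 * (n + 3) + 3)).
  by apply: recursive_disk_list; prove_recursive.
(* [M] exceeds [2 * N] so that the vertical error (2^N + 1) / 2^M is at most 2^-N; the total error
   is at most 3 * 2^-N, and [N = n + 3] brings it below 2^-n. *)
exists c => n; set N := (n + 3)%N; set M := (2 * N + 3)%N.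
have leM : (N + 3 <= M)%N by rewrite leq_add2r leq_pmull.
have [L evL LP] : exists2 L, Defs.eval (fun=> 0%N) c n L & forall d,
    d \in CodeSeq.decode L <->
    exists i j, grid_fits N M i j /\ d = disk_number M i j.
  by exists (disk_list N M); [exact: cP|move=> d; exact: mem_disk_list].
exists L => //; set D := disks_of_code _.
have DP z : D z <-> exists i j, grid_fits N M i j /\
    dist (grid_point M i j) z <= 2 ^- M.
  split=> [[d /= /LP[i [j [fits ->]]]]|[i [j [fits dz]]]].
    by rewrite disk_numberE => dz; exists i, j.
  exists (disk_number M i j); last by rewrite disk_numberE.
  by apply/LP; exists i, j.
have N0 : 0 < 2 ^- N :> R by rewrite invr_gt0 exprn_gt0.
have M0 : 0 < 2 ^- M :> R by rewrite invr_gt0 exprn_gt0.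
have NM : (2 ^+ N + 1) / 2 ^+ M <= 2 ^- N :> R.
  have E0 : 0 < 2 ^+ N :> R by rewrite exprn_gt0.
  have E1 : 1 <= 2 ^+ N :> R by rewrite exprn_ege1// ler1n.
  rewrite ler_pdivrMr ?exprn_gt0// /M mul2n -addnn -addnA exprD mulKf ?gt_eqF//.
  have -> : 2 ^+ (N + 3) = 2 ^+ N * 8 :> R by rewrite exprD -(natrX R 2 3).
  by lra.
have leMN : 2 ^- M <= 2 ^- N :> R.
  by apply: pow2_le; apply: leq_trans leM; exact: leq_addr.
have nN : 3 * 2 ^- N < 2 ^- n :> R.
  rewrite /N exprD invfM.
  have n0 : 0 < 2 ^- n :> R by rewrite invr_gt0 exprn_gt0.
  have -> : 2 ^+ 3 = 8 :> R by rewrite -natrX.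
  by lra.
have near (A : set (R * R)) (z z' : R * R) : A z' -> dist z z' <= 3 * 2 ^- N ->
    (dist_to A z <= (3 * 2 ^- N)%:E)%E.
  move=> Az' dz; apply: le_trans (_ : (dist z z')%:E <= _)%E;
    last by rewrite lee_fin.
  by apply: ereal_inf_lbound; exists z'.
apply: (@le_lt_trans _ _ (3 * 2 ^- N)%:E); last by rewrite lte_fin.
rewrite /hausdorff_dist ge_max; apply/andP; split; apply: ge_ereal_sup.
  move=> _ [z /DP[i [j [fits dz]]] <-].
  have [z' [Kz' z1 z2]] := grid_fits_near leM fits.
  apply: (near K _ z') => //; apply: le_trans (dist_le _ _) _; rewrite z2.
  have := le_trans (dist_ge1 _ _) dz; have := le_trans (dist_ge2 _ _) dz.
  rewrite ![`|(grid_point _ _ _).2 - _|]distrC; move: z1.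
  rewrite !ler_norml => ? ? ?.
  have : `|z.1 - z'.1| <= 2 ^- M + 2 ^- N by rewrite ler_norml; lra.
  have : `|z.2 - (grid_point M i j).2| <= 2 ^- M by rewrite ler_norml; lra.
  by lra.
move=> _ [z Kz <-]; have [i [j [fits z1 z2]]] := near_grid_fits leM Kz.
apply: (near D _ (grid_point M i j)).
  apply/DP; exists i, j; split=> //.
  by rewrite /dist !subrr expr0n addr0 sqrtr0 ltW.
by apply: le_trans (dist_le _ _) _; lra.
Qed.

(** The two rims of the fjord are boundary points at height 1 and distance 2^-(n+t+3). The
    projection of a connected set joining them is an interval containing [tip n], and over it the
    boundary lies at least [tip n / 4] lower. *)
Lemma fjord_modulus_gt (a : R) (m : R -> R) n t r :
  local_connectivity_modulus (boundary (fjord_domain T)) a m -> T n t ->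
  0 < r -> r < a -> 2 ^- (n + t + 3) < r -> tip R n / 4 < m r.
Proof.
move=> [_ mP _] Tnt r0 ra er.
have tn := tip_gt0 R n; have tn2 := tip_le_half R n.
have E0 : 0 < 2 ^+ t.+1 :> R by rewrite exprn_gt0.
pose e := tip R n / 4 / 2 ^+ t.+1.
have eE : e * 2 ^+ t.+1 = tip R n / 4 by rewrite divfK// gt_eqF.
have e0 : 0 < e by rewrite !divr_gt0.
have e2 := exp2_ge2 R t.
have e8 : e <= tip R n / 8 by nra.
have e2N : 2 * e = 2 ^- (n + t + 3) by exact: double_half_width.
have top s : `|s - tip R n| = e -> boundary (fjord_domain T) (s, 1).
  move=> se; have sb : - e <= s - tip R n <= e by rewrite -ler_norml se.
  have d0 : depth T s = 0.
    have /(depth_near_tip T_functional)[//|[t' Tnt' ->]] :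
      `|s - tip R n| <= tip R n / 4 by rewrite se; lra.
    rewrite (T_functional Tnt' Tnt) /bump se.
    by rewrite [2 ^+ _ * _]mulrC eE subrr maxxx.
  apply/boundary_fjordP => //; split;
    last by apply: Or44; rewrite /= /height d0 subr0.
  by split=> /=; rewrite /height ?d0; lra.
have b1 : boundary (fjord_domain T) (tip R n - e, 1).
  by apply: top; rewrite addrAC subrr add0r normrN gtr0_norm.
have b2 : boundary (fjord_domain T) (tip R n + e, 1).
  by apply: top; rewrite addrAC subrr add0r gtr0_norm.
have [|L [LW cL L1 L2 dL]] := mP _ _ r b1 b2 _ ra.
  apply: le_lt_trans (dist_le _ _) _; rewrite /= subrr normr0 addr0.
  by rewrite ltr0_norm; lra.
have [q Lq q1] : exists2 q, L q & q.1 = tip R n.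
  have /connected_intervalP ivl : connected (fst @` L).
    apply: connected_continuous_connected => //.
    by apply: continuous_subspaceT => z; exact: cvg_fst.
  have l1 : (fst @` L) (tip R n - e) by exists (tip R n - e, 1).
  have l2 : (fst @` L) (tip R n + e) by exists (tip R n + e, 1).
  have /(ivl _ _ l1 l2)[q Lq q1] : tip R n - e <= tip R n <= tip R n + e.
    by apply/andP; split; lra.
  by exists q.
have d4 : depth T (tip R n) = tip R n / 4.
  by rewrite (depth_bump T_functional Tnt) bump_tip// divr_gt0.
have low : q.2 <= 1 - tip R n / 4.
  have /(boundary_fjordP T_functional)[_ qb] := LW _ Lq.
  by case: qb; rewrite ?q1 /height ?d4; lra.
rewrite -lte_fin; apply: le_lt_trans dL; apply: le_trans (diam_ge L1 Lq).
rewrite lee_fin; apply: le_trans (dist_ge2 _ _) => /=.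
by rewrite ger0_norm; lra.
Qed.

(* Once [m (2 ^- k) < tip n / 4], the stage [t] at which [n] appears is less
   than [k], so that a bounded search decides whether [n] ever appears. *)
Lemma fjord_modulus_decides (a : R) (m : R -> R) : 0 < a ->
  local_connectivity_modulus (boundary (fjord_domain T)) a m ->
  computable_on a m -> decidable_pred (fun n => exists t, f (cpair n t) = 0%N).
Proof.
move=> a0 mlc [c cP].
(* The shift [k0] puts all the dyadic arguments [x k] inside (0, a). *)
have [k0 k0P] := tip_small a0.
pose x k : R := tip R (k0 + k).
have x0 k : 0 < x k by exact: tip_gt0.
have xa k : x k < a by apply: k0P; exact: leq_addr.
pose Q k := cpair (cpair 1 0) (2 ^ (k0 + k).+1 - 1).
have QE k : ratr (rat_of_code (Q k)) = x k.
  rewrite ratr_rat_of_code !cpairK /= subr0 subn1 prednK ?expn_gt0//.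
  by rewrite natrX div1r.
have [q qQ] : recursive Q by rewrite /Q; prove_recursive.
have ex kj : exists v, Defs.eval (fun=> Q (unpair kj).1) c (unpair kj).2 v /\
    `|ratr (rat_of_code v) - m (x (unpair kj).1)| < 2 ^- (unpair kj).2.
  have ora : oracle_for (x (unpair kj).1) (fun=> Q (unpair kj).1).
    by move=> j; rewrite QE subrr normr0 invr_gt0 exprn_gt0.
  by have [v] := cP _ _ (x0 _) (xa _) ora (unpair kj).2; exists v.
have [val valP] := choice ex.
have rval : recursive val.
  exists (internalize q c) => phi kj; have [ev _] := valP kj.
  by rewrite -{1}(unpairK kj); apply: eval_internalize ev.
(* With error 2^-(n+5), a value below 2^-(n+4) certifies that [m (x k)] is below 3 * 2^-(n+5), less
   than [tip n / 4]. Conversely it occurs as soon as [m (x k)] is below 2^-(n+5), so the search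
   ends. *)
pose v n k := val (cpair k (n + 5)).
have vP n k : `|ratr (rat_of_code (v n k)) - m (x k)| < 2 ^- (n + 5).
  by have [_] := valP (cpair k (n + 5)); rewrite cpairK.
(* The comparison of the rational with 2^-(n+4), cross-multiplied; truncation to 0 treats negative
   numerators correctly. *)
pose g nk := let w := v (unpair nk).1 (unpair nk).2 in
  ((((unpair (unpair w).1).1 - (unpair (unpair w).1).2) *
    2 ^ ((unpair nk).1 + 4)).+1 - (unpair w).2.+1)%N.
have gP n k : g (cpair n k) = 0%N <->
    ratr (rat_of_code (v n k)) < 2 ^- (n + 4) :> R.
  rewrite /g cpairK /= ratr_rat_of_code.
  set p := (unpair (unpair _).1).1; set p' := (unpair (unpair _).1).2.
  set d := (unpair _).2.
  have d0 : 0 < d.+1%:R :> R by rewrite ltr0n.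
  have E0 : 0 < 2 ^+ (n + 4) :> R by rewrite exprn_gt0.
  rewrite ltr_pdivrMr// mulrC ltr_pdivlMr//.
  have -> : ((p%:R - p'%:R) * 2 ^+ (n + 4) < d.+1%:R :> R)
      = ((p - p') * 2 ^ (n + 4) < d.+1)%N.
    rewrite -(ltr_nat R) natrM natrX natr_subn_max maxr_pMl ?ltW// mul0r.
    by rewrite gt_max d0.
  by rewrite -subn_eq0; split=> /eqP.
have rg : recursive g.
  have rv : recursive (fun nk => v (unpair nk).1 (unpair nk).2).
    by apply: recursive_comp rval _; prove_recursive.
  by rewrite /g; repeat first [apply: rv | recursive_step].
have pow5 n : 2 ^- (n + 5) = tip R n.+4 by rewrite !addnS addn0.
have pow4 n : 2 ^- (n + 4) = tip R n.+3 by rewrite !addnS addn0.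
have [k rk kP] : exists2 k, recursive k & forall n, g (cpair n (k n)) = 0%N.
  apply: recursive_mu => // n.
  have e0 : 0 < 2 ^- (n + 5) :> R by rewrite invr_gt0 exprn_gt0.
  have [_ _ /cvgrPdist_lt/(_ _ e0)] := mlc.
  move=> [d /= d0 dP]; have [N ltd] := tip_small d0.
  exists N; apply/gP.
  have xN : x N < d by apply: ltd; exact: leq_addl.
  have := dP (x N); rewrite /ball /= !sub0r !normrN gtr0_norm//.
  move=> /(_ xN (x0 N)); have := vP n N; rewrite !pow5 pow4 !ltr_norml.
  by rewrite (tipS R n.+3); lra.
have small n : m (x (k n)) < tip R n / 4.
  have /gP := kP n; have := vP n (k n); rewrite ltr_norml pow5 pow4.
  rewrite (tipS R n) (tipS R n.+1) (tipS R n.+2) (tipS R n.+3).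
  by have := tip_gt0 R n.+4; lra.
have bound n t : T n t -> (t < k0 + k n + 1)%N.
  move=> Tnt; rewrite ltnNge; apply/negP => le.
  have := fjord_modulus_gt mlc Tnt (x0 (k n)) (xa (k n)).
  have -> : 2 ^- (n + t + 3) < x (k n).
    rewrite ltf_pV2 ?posrE ?exprn_gt0// ltr_eXn2l ?ltr1n//.
    rewrite addn3 ltnS; apply: leq_trans (_ : (n + t).+1 <= _)%N => //.
    by rewrite ltnS; apply: leq_trans (ltnW _) (leq_addl _ _); rewrite -addn1.
  by move=> /(_ isT); have := small n; lra.
apply: (decidable_ext (P := fun n =>
    ~ (\sum_(t < k0 + k n + 1) (1 - f (cpair n t)) = 0)%N)).
  move=> n; split=> [nz|[t ft]].
    apply: contrapT => nt; apply: nz; rewrite big1// => t _.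
    apply/eqP; rewrite subn_eq0 lt0n; apply/eqP => ft; apply: nt.
    by exists t.
  have ltt : (t < k0 + k n + 1)%N by apply: bound; apply/eqP.
  move=> /eqP; rewrite sum_nat_eq0 => /forallP /(_ (Ordinal ltt)).
  by rewrite /= ft.
apply: decidable_not; apply: decidable_eq; last exact: recursive_const.
apply: (recursive_sum (F := fun n t => 1 - f (cpair n t))%N).
  apply: recursive_sub; first exact: recursive_const.
  by apply: recursive_comp f_recursive _; prove_recursive.
by repeat first [apply: rk | recursive_step].
Qed.

End Computability.

Theorem theorem4p6 (R : realType) :
  exists (W : set (R * R)) (w : R * R),
    [/\ pointed_domain W w,
        bounded_set W,
        locally_connected (boundary W),
        computable_compact (closure W) &
        (exists (a : R) (eta : R -> R),
           [/\ 0 < a, caratheodory_modulus W w a eta, computable_on a eta &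
               eta r @[r --> 0^'+] --> (0 : R)])
        /\
        ~ (exists (a : R) (m : R -> R),
             [/\ 0 < a, local_connectivity_modulus (boundary W) a m &
                 computable_on a m])].
Proof.
have [f [rf f_functional nd]] := undecidable_first_stage.
pose T n t := f (cpair n t) == 0%N.
have T_functional n t t' : T n t -> T n t' -> t = t'.
  by move=> /eqP + /eqP; exact: f_functional.
exists (fjord_domain T), (1 / 2, 1 / 2); split.
- split; first exact: open_fjord_domain.
    exact: fjord_domain_simply_connected.
  by split=> /=; have := height_bounds T_functional (1 / 2 : R); lra.
- exact: fjord_domain_bounded.
- exact: boundary_fjord_locally_connected.
- by rewrite closure_fjord_domain//; exact: fjord_closure_computable.
split; last first.
  by move=> [a [m [a0 mlc mcomp]]]; apply: nd; exact: fjord_modulus_decides mcomp.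
exists (1 / 32), (fun r => 32 * r); split.
- by lra.
- exact: fjord_caratheodory_modulus.
- exact: computable_on_scale32.
apply: cvg_at_right_filter; rewrite -[X in _ --> X](mulr0 32).
by apply: cvgM; [exact: cvg_cst|exact: cvg_id].
Qed.
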